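(* Let $X$ be a smooth and compact complex surface with minimal model $Y$, $Y\not\cong X$, where $Y$ is either a complex torus or a product $C\times W$ with $C$ an elliptic curve and $W$ a smooth curve of genus at least two. Then $H^0(X,S^2T_X)=0$.
   Context: $T_X$ is the (holomorphic) tangent bundle of $X$ and $S^2$ denotes the second symmetric power. That $Y$ is the minimal model of $X$ means $Y$ is a minimal smooth surface and $X$ is obtained from $Y$ by a finite sequence of blow-ups of points. *)

(* Defs.v *)
From HB Require Import structures.
From mathcomp Require Import all_boot all_order all_algebra.
From mathcomp Require Import complex.
From mathcomp Require Import all_classical all_reals all_analysis.
Import Order.TTheory GRing.Theory Num.Theory.
Import numFieldNormedType.Exports.

Set Implicit Arguments.
Unset Strict Implicit.
Unset Printing Implicit Defensive.

Local Open Scope classical_set_scope.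
Local Open Scope ring_scope.

(* MathComp-Analysis equips every numClosedFieldType with its topology and norm,
   but these are not inferred on the bare type R[i]. *)
Definition Cplx (R : realType) : numClosedFieldType := R[i]%C.

(* Points of C^n and tangent vectors are row vectors, so the differential of a
   map f at z sends v to v *m jacobian f z.  Over the field Cplx R,
   [differentiable] is complex Fréchet differentiability, so a map that is
   differentiable at every point of an open set is holomorphic there. *)

Section Manifolds.
Variable R : realType.
Local Notation C := (Cplx R).

Record chart (T : topologicalType) (n : nat) := Chart {
  dom : set T;
  cod : set 'rV[C]_n;
  coord : T -> 'rV[C]_n;
  point : 'rV[C]_n -> T;
  dom_open : open dom;
  cod_open : open cod;
  coord_cod : forall x, dom x -> cod (coord x);
  point_dom : forall z, cod z -> dom (point z);
  coordK : forall x, dom x -> point (coord x) = x;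
  pointK : forall z, cod z -> coord (point z) = z;
  coord_continuous : forall x, dom x -> {for x, continuous coord};
  point_continuous : forall z, cod z -> {for z, continuous point} }.

Definition transition (T : topologicalType) n (phi psi : chart T n) :
  'rV[C]_n -> 'rV[C]_n := coord psi \o point phi.

Definition overlap (T : topologicalType) n (phi psi : chart T n) :
  set 'rV[C]_n := [set z | cod phi z /\ dom psi (point phi z)].

Definition holomorphic_transition (T : topologicalType) n
    (phi psi : chart T n) : Prop :=
  forall z, overlap phi psi z -> differentiable (transition phi psi) z.

Record complexManifold (n : nat) := ComplexManifold {
  carrier :> topologicalType;
  atlas : set (chart carrier n);
  manifold_hausdorff : hausdorff_space carrier;
  manifold_second_countable : @second_countable carrier;
  atlas_cover : forall x : carrier, exists2 phi, atlas phi & dom phi x;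
  atlas_holomorphic : forall phi psi,
    atlas phi -> atlas psi -> holomorphic_transition phi psi }.

End Manifolds.

Section HolomorphicMaps.
Variable R : realType.

Definition holomorphic_at n m (X : complexManifold R n)
    (Y : complexManifold R m) (f : X -> Y) (x : X) : Prop :=
  {for x, continuous f} /\
  forall (phi : chart R X n) (psi : chart R Y m),
    atlas phi -> atlas psi -> dom phi x -> dom psi (f x) ->
    differentiable (coord psi \o f \o point phi) (coord phi x).

Definition holomorphic n m (X : complexManifold R n)
    (Y : complexManifold R m) (f : X -> Y) : Prop :=
  forall x, holomorphic_at f x.

Definition biholomorphic n (X Y : complexManifold R n) : Prop :=
  exists (f : X -> Y) (g : Y -> X),
    [/\ holomorphic f, holomorphic g, cancel f g & cancel g f].

(* Membership in the maximal atlas, i.e. arbitrary local holomorphic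
   coordinates. *)
Definition holomorphic_chart n (X : complexManifold R n)
    (phi : chart R X n) : Prop :=
  forall psi : chart R X n, atlas psi ->
    holomorphic_transition phi psi /\ holomorphic_transition psi phi.

Definition compact_connected n (X : complexManifold R n) : Prop :=
  compact [set: X] /\ connected [set: X].

End HolomorphicMaps.

Section ProductTopology.

Lemma hausdorff_prod (T U : topologicalType) :
  hausdorff_space T -> hausdorff_space U -> hausdorff_space (T * U)%type.
Proof.
move=> hT hU [x y] [x' y'] cl; congr pair.
- apply: hT => A B nA nB.
  have [||[a b] [/= [Aa _] [Ba _]]] :=
    cl (A `*` setT) (B `*` setT) _ _.
  + by exists (A, setT) => //; split => //; exact: filterT.
  + by exists (B, setT) => //; split => //; exact: filterT.
  by exists a.
- apply: hU => A B nA nB.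
  have [||[a b] [/= [_ Ab] [_ Bb]]] :=
    cl (setT `*` A) (setT `*` B) _ _.
  + by exists (setT, A) => //; split => //; exact: filterT.
  + by exists (setT, B) => //; split => //; exact: filterT.
  by exists b.
Qed.

Lemma open_setX (T U : topologicalType) (A : set T) (B : set U) :
  open A -> open B -> open (A `*` B).
Proof.
rewrite !openE => oA oB [x y] [/= Ax By].
by exists (A, B) => //; split; [exact: oA | exact: oB].
Qed.

Lemma second_countable_prod (T U : topologicalType) :
  @second_countable T -> @second_countable U ->
  @second_countable (T * U)%type.
Proof.
move=> [BT cT [oT bT]] [BU cU [oU bU]].
exists ((fun p : set T * set U => p.1 `*` p.2) @` (BT `*` BU)).
  by apply: card_le_trans (card_image_le _ _) _; exact: countableX.
split; first by move=> _ [[A B] [/= /oT oA /oU oB] <-]; exact: open_setX.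
move=> [x y] S [[A B] [/= nA nB] AB].
have [A' [BA' A'x] A'A] := bT x A nA.
have [B' [BB' B'y] B'B] := bU y B nB.
exists (A' `*` B'); first by split=> //; exists (A', B').
by move=> [a b] [/= /A'A ? /B'B ?]; exact: AB.
Qed.

Lemma continuous_pair (S T U : topologicalType) (f : S -> T) (g : S -> U) x :
  {for x, continuous f} -> {for x, continuous g} ->
  {for x, continuous (fun y => (f y, g y))}.
Proof.
move=> cf cg A [[B D] [/= nB nD] BD].
have nfg := @filterI _ (nbhs x) _ _ _ (cf _ nB) (cg _ nD).
apply: (@filterS _ (nbhs x) _ (f @^-1` B `&` g @^-1` D)); last exact: nfg.
by move=> y [fy gy]; exact: BD.
Qed.

End ProductTopology.

Lemma continuous_row_mx_pair (K : numFieldType) (n m : nat) :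
  continuous (fun p : 'rV[K]_n * 'rV[K]_m => row_mx p.1 p.2).
Proof.
move=> [a b] A /nbhs_ballP[e e0 eA].
exists (ball a e, ball b e) => /=; first by split; exact: nbhsx_ballx.
move=> [c d] [/= [_ ac] [_ bd]]; apply: eA; split=> // i j /=.
by rewrite !mxE; case: splitP => k _; [exact: ac|exact: bd].
Qed.

Lemma differentiable_row_mx (K : numFieldType) (V : normedModType K) (n m : nat)
    (f : V -> 'rV[K]_n) (g : V -> 'rV[K]_m) v :
  differentiable f v -> differentiable g v ->
  differentiable (fun x => row_mx (f x) (g x)) v.
Proof.
move=> df dg.
pose r (p : 'rV[K]_n * 'rV[K]_m) : 'rV[K]_(n + m) := row_mx p.1 p.2.
have r_lin : linear r.
  by move=> a [b c] [b' c']; rewrite /r /= scale_row_mx add_row_mx.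
pose rM := GRing.isLinear.Build _ _ _ _ r r_lin.
pose rL : {linear _ -> _} := HB.pack r rM.
have dr p : differentiable r p.
  have -> : r = rL by [].
  exact/linear_differentiable/continuous_row_mx_pair.
exact: (@differentiable_comp _ _ _ _ (fun x => (f x, g x)) r)
  (differentiable_pair df dg) (dr _).
Qed.

Section ProductManifold.
Variables (R : realType) (n m : nat).
Local Notation C := (Cplx R).

Section ProductChart.
Variables (T U : topologicalType) (phi : chart R T n) (psi : chart R U m).

Let pdom : set (T * U) := dom phi `*` dom psi.
Let pcod : set 'rV[C]_(n + m) :=
  (lsubmx @^-1` cod phi) `&` (rsubmx @^-1` cod psi).
Let pcoord (p : T * U) : 'rV[C]_(n + m) :=
  row_mx (coord phi p.1) (coord psi p.2).
Let ppoint (z : 'rV[C]_(n + m)) : T * U :=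
  (point phi (lsubmx z), point psi (rsubmx z)).

Let pdom_open : open pdom.
Proof. exact: open_setX (dom_open phi) (dom_open psi). Qed.

Let pcod_open : open pcod.
Proof.
apply: openI; apply: open_comp; try exact: cod_open.
- by move=> z _; exact: continuous_lsubmx.
- by move=> z _; exact: continuous_rsubmx.
Qed.

Let pcoord_cod p : pdom p -> pcod (pcoord p).
Proof.
by move=> [p1 p2]; split; rewrite /= ?row_mxKl ?row_mxKr; exact: coord_cod.
Qed.

Let ppoint_dom z : pcod z -> pdom (ppoint z).
Proof. by move=> [z1 z2]; split; exact: point_dom. Qed.

Let pcoordK p : pdom p -> ppoint (pcoord p) = p.
Proof.
by case: p => x y [/= ? ?]; rewrite /ppoint /pcoord row_mxKl row_mxKr !coordK.
Qed.

Let ppointK z : pcod z -> pcoord (ppoint z) = z.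
Proof. by move=> [z1 z2]; rewrite /ppoint /pcoord /= !pointK// hsubmxK. Qed.

Let pcoord_continuous p : pdom p -> {for p, continuous pcoord}.
Proof.
move=> [/= p1 p2].
apply: (@continuous_comp _ _ _ (fun p => (coord phi p.1, coord psi p.2))
  (fun q => row_mx q.1 q.2)); last exact: continuous_row_mx_pair.
apply: continuous_pair.
- apply: (@continuous_comp _ _ _ fst (coord phi)); first exact: cvg_fst.
  exact: coord_continuous.
- apply: (@continuous_comp _ _ _ snd (coord psi)); first exact: cvg_snd.
  exact: coord_continuous.
Qed.

Let ppoint_continuous z : pcod z -> {for z, continuous ppoint}.
Proof.
move=> [/= z1 z2].
apply: (@continuous_pair _ _ _ (point phi \o lsubmx) (point psi \o rsubmx)).
- apply: (@continuous_comp _ _ _ lsubmx (point phi)).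
    exact: continuous_lsubmx.
  exact: point_continuous.
- apply: (@continuous_comp _ _ _ rsubmx (point psi)).
    exact: continuous_rsubmx.
  exact: point_continuous.
Qed.

Definition prod_chart : chart R (T * U)%type (n + m) :=
  Chart pdom_open pcod_open pcoord_cod ppoint_dom pcoordK ppointK
    pcoord_continuous ppoint_continuous.

End ProductChart.

Variables (X : complexManifold R n) (Y : complexManifold R m).

Definition prod_atlas : set (chart R (X * Y)%type (n + m)) :=
  [set chi | exists phi psi,
    [/\ @atlas R n X phi, @atlas R m Y psi & chi = prod_chart phi psi]].

Lemma prod_atlas_cover (p : X * Y) :
  exists2 chi, prod_atlas chi & dom chi p.
Proof.
have [phi aphi phip] := atlas_cover p.1.
have [psi apsi psip] := atlas_cover p.2.
by exists (prod_chart phi psi) => //; exists phi, psi.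
Qed.

Lemma prod_atlas_holomorphic chi chi' :
  prod_atlas chi -> prod_atlas chi' -> holomorphic_transition chi chi'.
Proof.
move=> [phi [psi [aphi apsi ->]]] [phi' [psi' [aphi' apsi' ->]]] z.
move=> [[/= z1 z2] [/= z1' z2']].
apply: (@differentiable_row_mx _ _ _ _ (transition phi phi' \o lsubmx)
  (transition psi psi' \o rsubmx)).
- apply: differentiable_comp; first exact: differentiable_lsubmx.
  by apply: atlas_holomorphic.
- apply: differentiable_comp; first exact: differentiable_rsubmx.
  by apply: atlas_holomorphic.
Qed.

Definition prod_manifold : complexManifold R (n + m) :=
  ComplexManifold
    (hausdorff_prod (@manifold_hausdorff R n X) (@manifold_hausdorff R m Y))
    (second_countable_prod (@manifold_second_countable R n X)
      (@manifold_second_countable R m Y))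
    prod_atlas_cover prod_atlas_holomorphic.

End ProductManifold.

Section Tensors.
Variables (R : realType) (n : nat) (X : complexManifold R n).
Local Notation C := (Cplx R).

(* A holomorphic 1-form is a family of coefficient vectors w phi, one for each
   chart phi of the atlas: on cod phi the form is \sum_i (w phi z)_i dz_i, and
   its value on a tangent vector v is v *m w phi z.  Values outside cod phi,
   or at charts outside the atlas, carry no information. *)
Definition holomorphic_1form (w : chart R X n -> 'rV[C]_n -> 'cV[C]_n) : Prop :=
  (forall phi, atlas phi -> forall z, cod phi z -> differentiable (w phi) z) /\
  (forall phi psi, atlas phi -> atlas psi ->
    forall z, overlap phi psi z ->
    w phi z = jacobian (transition phi psi) z *m w psi (transition phi psi z)).

(* A holomorphic section of S^2 T_X is, in each chart, a symmetric matrix of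
   holomorphic coefficients, standing for \sum_(i, j) (s phi z)_ij d_i d_j;
   the symmetric square v v of a tangent vector has matrix v^T *m v, which
   gives the transformation rule. *)
Definition holomorphic_S2T (s : chart R X n -> 'rV[C]_n -> 'M[C]_n) : Prop :=
  [/\ forall phi, atlas phi -> forall z, cod phi z -> differentiable (s phi) z,
      forall phi, atlas phi -> forall z, cod phi z -> (s phi z)^T = s phi z
    & forall phi psi, atlas phi -> atlas psi ->
      forall z, overlap phi psi z ->
      s psi (transition phi psi z) =
        (jacobian (transition phi psi) z)^T *m s phi z
          *m jacobian (transition phi psi) z].

Definition H0_S2T_eq0 : Prop :=
  forall s, holomorphic_S2T s ->
  forall phi, atlas phi -> forall z, cod phi z -> s phi z = 0.

End Tensors.

Section Curves.
Variables (R : realType) (W : complexManifold R 1).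
Local Notation C := (Cplx R).

(* g is the dimension of the space H^0(W, K_W) of holomorphic 1-forms. *)
Definition has_genus (g : nat) : Prop :=
  exists b : 'I_g -> chart R W 1 -> 'rV[C]_1 -> 'cV[C]_1,
  [/\ forall i, holomorphic_1form (b i),
      forall c : 'I_g -> C,
        (forall phi, atlas phi -> forall z, cod phi z ->
          \sum_i c i *: b i phi z = 0) ->
        forall i, c i = 0
    & forall w, holomorphic_1form w -> exists c : 'I_g -> C,
        forall phi, atlas phi -> forall z, cod phi z ->
          w phi z = \sum_i c i *: b i phi z].

End Curves.

Section Tori.
Variables (R : realType) (n : nat).
Local Notation C := (Cplx R).

Definition real_free (e : 'I_(2 * n) -> 'rV[C]_n) : Prop :=
  forall c : 'I_(2 * n) -> R,
    \sum_i ((c i)%:C%C : C) *: e i = 0 -> forall i, c i = 0.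

Definition lattice (e : 'I_(2 * n) -> 'rV[C]_n) : set 'rV[C]_n :=
  [set v | exists k : 'I_(2 * n) -> int, v = \sum_i e i *~ k i].

(* Y is isomorphic to C^n / L for a lattice L of rank 2n; q is the quotient
   map, whose local inverses are holomorphic coordinates of Y. *)
Definition complex_torus (Y : complexManifold R n) : Prop :=
  exists (e : 'I_(2 * n) -> 'rV[C]_n) (q : 'rV[C]_n -> Y),
  [/\ real_free e,
      forall y, exists z, q z = y,
      forall z w, q z = q w <-> lattice e (z - w)
    & forall z, exists phi : chart R Y n,
        [/\ holomorphic_chart phi, cod phi z
          & forall w, cod phi w -> point phi w = q w]].

End Tori.

Definition elliptic_curve (R : realType) (E : complexManifold R 1) : Prop :=
  complex_torus E.

Section BlowUps.
Variable R : realType.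
Local Notation C := (Cplx R).

Definition pt2 (a b : C) : 'rV[C]_2 := \row_(j < 2) if j == 0 then a else b.

(* The blow-up of C^2 at the origin is the set of pairs (z, l) of a point z on
   a line l through 0.  It has two charts: (u, v) stands for the point (u, uv)
   on the line spanned by (1, v), and (s, t) for the point (st, t) on the line
   spanned by (s, 1); the two lines agree iff s v = 1. *)
Definition sigma0 (w : 'rV[C]_2) : 'rV[C]_2 := pt2 (w 0 0) (w 0 0 * w 0 1).
Definition sigma1 (w : 'rV[C]_2) : 'rV[C]_2 := pt2 (w 0 0 * w 0 1) (w 0 1).

(* pi is biholomorphic away from p, and in some local coordinates psi of Y
   centred at p it is the blow-up of the origin, with charts phi0 and phi1. *)
Definition is_blowup (X Y : complexManifold R 2) (pi : X -> Y) (p : Y) : Prop :=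
  [/\ holomorphic pi,
      exists s : Y -> X,
        [/\ forall y, y <> p -> holomorphic_at s y,
            forall y, y <> p -> pi (s y) = y
          & forall x, pi x <> p -> s (pi x) = x]
    & exists (psi : chart R Y 2) (phi0 phi1 : chart R X 2),
        [/\ [/\ holomorphic_chart psi, holomorphic_chart phi0
              & holomorphic_chart phi1],
            dom psi p /\ coord psi p = 0,
            pi @^-1` dom psi = dom phi0 `|` dom phi1,
            [/\ cod phi0 = sigma0 @^-1` cod psi,
                cod phi1 = sigma1 @^-1` cod psi,
                forall x, dom phi0 x ->
                  coord psi (pi x) = sigma0 (coord phi0 x)
              & forall x, dom phi1 x ->
                  coord psi (pi x) = sigma1 (coord phi1 x)]
          & [/\ forall x, dom phi0 x -> (dom phi1 x <-> coord phi0 x 0 1 <> 0),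
                forall x, dom phi1 x -> (dom phi0 x <-> coord phi1 x 0 0 <> 0)
              & forall x, dom phi0 x -> dom phi1 x ->
                  coord phi1 x 0 0 * coord phi0 x 0 1 = 1]]].

Inductive iterated_blowup (Y : complexManifold R 2) :
    complexManifold R 2 -> Prop :=
| iterated_blowup0 X : biholomorphic X Y -> iterated_blowup Y X
| iterated_blowupS (Z X : complexManifold R 2) (pi : X -> Z) (p : Z) :
    iterated_blowup Y Z -> is_blowup pi p -> iterated_blowup Y X.

(* By Castelnuovo's criterion this is the absence of (-1)-curves. *)
Definition minimal_surface (Y : complexManifold R 2) : Prop :=
  forall (Z : complexManifold R 2) (pi : Y -> Z) (p : Z), ~ is_blowup pi p.

Definition minimal_model (X Y : complexManifold R 2) : Prop :=
  [/\ compact_connected Y, minimal_surface Y & iterated_blowup Y X].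

End BlowUps.

(* Main.v *)
Require Import Defs.
From HB Require Import structures.
From mathcomp Require Import all_boot all_order all_algebra.
From mathcomp Require Import complex.
From mathcomp Require Import all_classical all_reals all_analysis.
From mathcomp Require Import zify ring lra.
Import Defs.
Import Order.TTheory GRing.Theory Num.Theory.
Import numFieldNormedType.Exports.
Set Implicit Arguments.
Unset Strict Implicit.
Unset Printing Implicit Defensive.
Local Open Scope classical_set_scope.
Local Open Scope ring_scope.

(**
Let X be obtained from Y by blow-ups. There is at least one of them, since X is
not isomorphic to Y; let pi : X -> Z be the last one, with centre p.

The surface Y carries two holomorphic 1-forms that are linearly independent at
the points of a dense set: the coordinate forms dz_1, dz_2 on a torus, and the
invariant form of C together with any nonzero form of W on the product C x W.
Blow-ups and isomorphisms are invertible over a dense set, so pulling back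
gives such a pair on Z and then on X. A pair of this kind is recorded as a
matrix w whose columns are the two forms ([generic_coframe]).

Let s be a section of S^2 T_X. The contractions s(pi^* w_i, pi^* w_j) are
holomorphic functions on X, which is compact and connected, hence they are
constants ([holomorphic_fun_cst]). Along the exceptional curve the differential
of pi has rank one, and its image runs through all the lines of T_p Z; one of
these lines lies in the kernel of w_i at p. So pi^* w_i vanishes at some point
of the curve ([blowup_pullback_vanishes]), and the constants are all zero.
Where the two forms pi^* w_i are a basis this gives s = 0, and s = 0 everywhere
by continuity ([blowup_H0_S2T_eq0]).

A holomorphic map is here a map with a complex differential at each point, so
the function theory that this uses is derived from that: the maximum principle
([strong_maximum]), the identity theorem ([identity_disc]), by which a nonzero
form on W vanishes on no open set, and the fact that the partial derivatives of
a holomorphic function are holomorphic ([derive_differentiable]), by which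
pulled back forms are holomorphic. The source of the three is Goursat's theorem
([goursat]), proved for Riemann sums in place of integrals. It gives a mean
value estimate, which the usual trick of taking powers sharpens to
|f(c)| <= max |f| over an annulus around c ([center_le_annulus]); from there one
passes to the maximum principle on discs ([max_modulus_disc]), to the Schwarz
lemma ([schwarz]), and to the three facts.
*)

(** * The modulus of complex numbers *)

Section Modulus.
Variable R : realType.
Local Notation C := (Cplx R).
Local Notation I := ('i%C : C).

(** The norm of [Cplx R] takes its values in [Cplx R] itself, where the order is
    partial; estimates are made on the underlying real number. *)
Definition modulus (z : C) : R := Normc.normc z.

Lemma normE (z : C) : `|z| = (modulus z)%:C%C.
Proof. by []. Qed.

Lemma modulus_ge0 z : 0 <= modulus z.
Proof. by rewrite -ler0c -normE. Qed.

Lemma modulusM z w : modulus (z * w) = modulus z * modulus w.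
Proof. exact: Normc.normcM. Qed.

Lemma modulusX z n : modulus (z ^+ n) = modulus z ^+ n.
Proof.
by elim: n => [|n IH]; rewrite ?expr0 ?exprS ?modulusM ?IH//; exact: Normc.normc1.
Qed.

Lemma modulusD z w : modulus (z + w) <= modulus z + modulus w.
Proof. exact: le_normcD. Qed.

Lemma modulus_eq0 z : (modulus z == 0) = (z == 0).
Proof. apply/eqP/eqP => [/Normc.eq0_normc//|->]; exact: Normc.normc0. Qed.

Lemma modulus_gt0 z : (0 < modulus z) = (z != 0).
Proof. by rewrite lt_neqAle eq_sym modulus_eq0 modulus_ge0 andbT. Qed.

Lemma modulusV z : modulus (z^-1) = (modulus z)^-1.
Proof. exact: Normc.normcV. Qed.

Lemma modulusN z : modulus (- z) = modulus z.
Proof. exact: normcN. Qed.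

Lemma modulusB z w : modulus (z - w : C) <= modulus z + modulus w.
Proof. by rewrite -(modulusN w); exact: modulusD. Qed.

Lemma modulusC (z w : C) : modulus (z - w) = modulus (w - z).
Proof. by rewrite -modulusN opprB. Qed.

Lemma modulus_dist (z w : C) : `|modulus z - modulus w| <= modulus (z - w).
Proof.
rewrite ler_norml; apply/andP; split.
  by have := modulusD (w - z) z; rewrite subrK modulusC; lra.
by have := modulusD (z - w) w; rewrite subrK; lra.
Qed.

Lemma halfC : (2^-1 : C) = (2^-1 : R)%:C%C.
Proof. by rewrite rmorphV ?unitfE ?pnatr_eq0// rmorph_nat. Qed.

Lemma modulus_real (x : R) : 0 <= x -> modulus (x%:C%C : C) = x.
Proof.
by move=> x0; apply: (@complexI R); rewrite -normE ger0_norm// ler0c.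
Qed.

Lemma modulus_nat n : modulus (n%:R : C) = n%:R.
Proof. by rewrite -(rmorph_nat (real_complex R)) modulus_real. Qed.

Lemma modulus1 : modulus (1 : C) = 1.
Proof. exact: (@modulus_nat 1). Qed.

Lemma modulus0 : modulus (0 : C) = 0.
Proof. exact: (@modulus_nat 0). Qed.

Lemma modulusI : modulus I = 1.
Proof. by rewrite /modulus /= expr0n expr1n add0r sqrtr1. Qed.

Lemma modulus_sqr (z : C) : modulus z ^+ 2 = complex.Re z ^+ 2 + complex.Im z ^+ 2.
Proof.
by case: z => x y; rewrite /modulus /= sqr_sqrtr// addr_ge0 ?sqr_ge0.
Qed.

Lemma parallelogram (w d : C) :
  modulus (w + d) ^+ 2 + modulus (w - d) ^+ 2 = 2 * modulus w ^+ 2 + 2 * modulus d ^+ 2.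
Proof. by rewrite !modulus_sqr; case: w => a b; case: d => a' b' /=; ring. Qed.

Lemma modulus_Re (z : C) : `|complex.Re z| <= modulus z.
Proof.
rewrite -(@ler_pXn2r _ 2%N) ?nnegrE ?modulus_ge0 ?normr_ge0// modulus_sqr.
by rewrite real_normK ?num_real// lerDl sqr_ge0.
Qed.

Lemma modulus_Im (z : C) : `|complex.Im z| <= modulus z.
Proof.
rewrite -(@ler_pXn2r _ 2%N) ?nnegrE ?modulus_ge0 ?normr_ge0// modulus_sqr.
by rewrite real_normK ?num_real// lerDr sqr_ge0.
Qed.

Definition of_parts (x y : R) : C := x%:C%C + I * y%:C%C.

Lemma modulus_of_parts x y : modulus (of_parts x y) <= `|x| + `|y|.
Proof.
have mr (r : R) : modulus (r%:C%C : C) = `|r|.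
  by rewrite /modulus /= expr0n addr0 sqrtr_sqr.
by rewrite (le_trans (modulusD _ _))// modulusM modulusI mul1r !mr.
Qed.

Lemma of_parts_eq0 x y : of_parts x y = 0 -> x = 0 /\ y = 0.
Proof.
rewrite /of_parts; move/eqP; rewrite eq_complex /= => /andP[/eqP h1 /eqP h2].
by split; [move: h1|move: h2]; rewrite !(mul0r, mul1r, mulr0, subr0, addr0, add0r, oppr0).
Qed.

Lemma modulus_of_parts1 (t : R) : -1 <= t <= 1 -> 1 <= modulus (of_parts 1 t) <= 2.
Proof.
move=> t1; apply/andP; split; last first.
  have t1' : `|t| <= 1 by rewrite ler_norml.
  by rewrite (le_trans (modulus_of_parts _ _))// normr1; lra.
have -> : of_parts 1 t = (1 +i* t)%C by rewrite /of_parts; simpc.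
by rewrite /modulus /= -[X in X <= _](@sqrtr1 R) ler_wsqrtr// expr1n lerDl sqr_ge0.
Qed.

Lemma nbhsCP (z : C) (A : set C) :
  nbhs z A <-> exists2 e : R, 0 < e & forall w, modulus (w - z) < e -> A w.
Proof.
split.
  move/nbhs_ballP => [e /= e0 eA].
  have eE : e = (complex.Re e)%:C%C by rewrite RRe_real// gtr0_real.
  exists (complex.Re e); first by rewrite -ltcR -eE.
  move=> w we; apply: eA; rewrite /ball/= distrC normE eE.
  by rewrite ltcR.
move=> [e e0 eA]; apply/nbhs_ballP; exists e%:C%C => /=; first by rewrite ltcR.
by move=> w; rewrite /ball/= distrC normE ltcR; exact: eA.
Qed.

Lemma modulus_continuous : continuous modulus.
Proof.
move=> z; apply/(@cvgrPdist_lt _ _ C (nbhs z)) => e e0; apply/nbhsCP; exists e => // w we.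
by rewrite (le_lt_trans (modulus_dist _ _))// modulusC.
Qed.

Lemma continuous_modulus_sub (c : C) : continuous (fun z : C => modulus (z - c)).
Proof.
move=> z; apply/(@cvgrPdist_lt _ _ C (nbhs z)) => e e0; apply/nbhsCP; exists e => // w we.
rewrite (le_lt_trans (modulus_dist _ _))// modulusC.
by rewrite (_ : w - c - (z - c) = w - z)//; ring.
Qed.

Definition disc (c : C) (r : R) : set C := [set z | modulus (z - c) <= r].

Lemma closed_disc c r : closed (disc c r).
Proof.
apply: (@closed_comp _ _ (fun z : C => modulus (z - c)) [set x | x <= r]).
  by move=> z _; exact: continuous_modulus_sub.
exact: closed_le.
Qed.

Lemma closed_codisc c r : closed [set z : C | r <= modulus (z - c)].
Proof.
apply: (@closed_comp _ _ (fun z : C => modulus (z - c)) [set x | r <= x]).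
  by move=> z _; exact: continuous_modulus_sub.
exact: closed_ge.
Qed.

Lemma compact_disc c r : compact (disc c r).
Proof.
pose g (p : R * R) : C := c + of_parts p.1 p.2.
have gc : continuous g.
  move=> p A /nbhsCP[e e0 eA].
  have e2 : 0 < e / 2 by lra.
  exists (ball p.1 (e / 2), ball p.2 (e / 2)) => /=.
    by split; exact: nbhsx_ballx.
  move=> [x y] [/=]; rewrite /ball/= => xe ye; apply: eA.
  have -> : g (x, y) - g p = of_parts (x - p.1) (y - p.2).
    by rewrite /g /of_parts /= !(rmorphB, rmorphN)/=; ring.
  by rewrite (le_lt_trans (modulus_of_parts _ _))//; rewrite (distrC x) (distrC y); lra.
have cK : compact (g @` (`[-r, r] `*` `[-r, r])).
  apply: continuous_compact; first exact: continuous_subspaceT.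
  by apply: compact_setX; exact: segment_compact.
apply: (@subclosed_compact _ _ _ (@closed_disc c r) cK) => z /= zr.
exists (complex.Re (z - c), complex.Im (z - c)); last first.
  rewrite /g /= -[RHS](subrK c) [RHS]addrC; congr (_ + _).
  by rewrite [RHS]complexE /of_parts.
have := modulus_Re (z - c); have := modulus_Im (z - c).
rewrite !ler_norml => /andP[i1 i2] /andP[r1 r2].
by split; rewrite /= in_itv/=; apply/andP; split; rewrite /disc/= in zr; lra.
Qed.

Lemma differentiable_modulus_continuous (f : C -> C) (z : C) :
  differentiable f z -> {for z, continuous (fun w => modulus (f w))}.
Proof.
move=> /differentiable_continuous fc.
by apply: continuous_comp => //; exact: modulus_continuous.
Qed.

Lemma modulus_max (f : C -> C) (A : set C) : compact A -> A !=set0 ->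
  (forall z, A z -> differentiable f z) ->
  exists2 b, A b & forall z, A z -> modulus (f z) <= modulus (f b).
Proof.
move=> cA A0 df.
have [|b /set_mem Ab bm] := @compact_EVT_max _ _ (fun z => modulus (f z)) A A0 cA.
  by apply: continuous_in_subspaceT => z /set_mem/df/differentiable_modulus_continuous.
by exists b => // z /mem_set; exact: bm.
Qed.

Lemma differentiable_approx (f : C -> C) (z : C) : differentiable f z ->
  forall e : R, 0 < e -> exists2 d : R, 0 < d &
    forall w, modulus (w - z) < d ->
    modulus (f w - f z - 'D_1 f z * (w - z)) <= e * modulus (w - z).
Proof.
move=> /derivable1_diffP df e e0.
move: (df) => /cvgrPdist_le /(_ e%:C%C); rewrite ltcR => /(_ e0).
move=> /nbhsCP[d d0 H]; exists d => // w wd.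
have [->|wz] := eqVneq w z.
  by rewrite !subrr mulr0 subr0 /modulus Normc.normc0 mulr0.
have := H (w - z); rewrite subr0 => /(_ wd); rewrite subr_eq0 => /(_ wz) /=.
rewrite scaler1 subrK normE lecR => h.
have -> : f w - f z - 'D_1 f z * (w - z)
  = - ('D_1 f z - (w - z)^-1 *: (f w - f z)) * (w - z).
  by rewrite /GRing.scale/=; field; rewrite subr_eq0.
by rewrite modulusM modulusN ler_wpM2r ?modulus_ge0.
Qed.

Lemma differentiable_scale (f : C -> C) (a c z : C) :
  differentiable f (c + a * z) -> differentiable (fun w => f (c + a * w)) z.
Proof.
move=> df.
have dg : differentiable (fun w : C => c + a * w) z.
  have -> : (fun w => c + a * w) =
    (cst c : C -> C) + (cst a : C -> C) * (id : C -> C) by [].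
  apply: differentiableD; first exact: differentiable_cst.
  apply: differentiableM; first exact: differentiable_cst.
  exact: ex_diff.
exact: (differentiable_comp dg df).
Qed.

Lemma differentiable_subc (c w : C) : differentiable (fun z : C => z - c) w.
Proof.
have -> : (fun z : C => z - c) = (id : C -> C) - cst c by [].
by apply: differentiableB; [exact: ex_diff|exact: differentiable_cst].
Qed.

Lemma differentiable_exp (f : C -> C) n w :
  differentiable f w -> differentiable (f ^+ n) w.
Proof.
move=> df; case: n => [|n]; last exact: differentiableX.
exact: (differentiable_cst (1 : C)).
Qed.

End Modulus.

(** * Riemann sums and Goursat's theorem *)

Section Sums.
Variable R : realType.
Local Notation C := (Cplx R).
Local Notation I := ('i%C : C).

Lemma exp2_lt (d : R) : 0 < d -> exists k, 2 ^- k < d.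
Proof.
move=> d0; exists (Num.truncn d^-1).+1.
rewrite invf_plt ?posrE ?exprn_gt0//.
have := truncnS_gt d^-1 => /lt_le_trans; apply.
by rewrite -natrX ler_nat ltnW// ltn_expl.
Qed.

(** The lower left corners increase and stay below the upper right ones, so they
    converge to their suprema. The bounds [0 <= x <= x'] are recorded because
    they force [x = 0] when the limit point is the origin. *)
Lemma bisection (B : nat -> R -> R -> Prop) :
  B 0%N 0 0 ->
  (forall k x y, B k x y -> exists b c : bool,
     B k.+1 (x + b%:R / 2 ^+ k.+1) (y + c%:R / 2 ^+ k.+1)) ->
  exists x' y', forall k, exists x y,
    [/\ B k x y, 0 <= x, x <= x' <= x + 2 ^- k, 0 <= y & y <= y' <= y + 2 ^- k].
Proof.
move=> B0 Bs.
have st k (p : R * R) : exists bc : bool * bool, B k p.1 p.2 ->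
    B k.+1 (p.1 + bc.1%:R / 2 ^+ k.+1) (p.2 + bc.2%:R / 2 ^+ k.+1).
  have [/Bs[b [c h]]|nB] := pselect (B k p.1 p.2); first by exists (b, c).
  by exists (true, true).
pose nx k p := projT1 (cid (st k p)).
pose s := fix s k : R * R := if k is k'.+1 then
   ((s k').1 + (nx k' (s k')).1%:R / 2 ^+ k'.+1,
    (s k').2 + (nx k' (s k')).2%:R / 2 ^+ k'.+1) else (0, 0).
have sB k : B k (s k).1 (s k).2.
  by elim: k => [//|k IH]; exact: (projT2 (cid (st k (s k)))).
have lim (u : nat -> R) : u 0%N = 0 ->
    (forall k, exists b : bool, u k.+1 = u k + b%:R / 2 ^+ k.+1) ->
    exists x', forall k, 0 <= u k /\ u k <= x' <= u k + 2 ^- k.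
  move=> u0 us.
  have p2 k : 0 < 2 ^- k :> R by rewrite invr_gt0 exprn_gt0.
  have h2 k : 2 ^- k = 2 ^- k.+1 + 2 ^- k.+1 :> R.
    by rewrite exprS; field; rewrite expf_neq0// pnatr_eq0.
  have step k : u k <= u k.+1 /\ u k.+1 + 2 ^- k.+1 <= u k + 2 ^- k.
    have [b ->] := us k; rewrite (h2 k).
    by have := p2 k.+1; case: b => /=; rewrite ?mul1r ?mul0r; lra.
  have mono k j : u k <= u (k + j)%N /\ u (k + j)%N + 2 ^- (k + j) <= u k + 2 ^- k.
    elim: j => [|j [IH1 IH2]]; first by rewrite addn0.
    by have [] := step (k + j)%N; rewrite addnS; split; lra.
  have le k j : u k <= u j + 2 ^- j.
    have [kj|/ltnW jk] := leqP k j.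
      have [] := mono k (j - k)%N; rewrite subnKC//.
      by have := p2 j; lra.
    have [] := mono j (k - j)%N; rewrite subnKC//.
    by have := p2 k; lra.
  have ubd j : ubound (range u) (u j + 2 ^- j) by move=> _ [k _ <-].
  have hs : has_sup (range u).
    by split; [exists (u 0%N), 0%N|exists (u 0%N + 2 ^- 0)].
  exists (sup (range u)) => k; split; last (apply/andP; split).
  - by have [+ _] := mono 0%N k; rewrite u0.
  - by apply: sup_upper_bound => //; exists k.
  - by apply: sup_le_ub => //; exact: (hs.1).
have [x' hx] : exists x', forall k, 0 <= (s k).1 /\ (s k).1 <= x' <= (s k).1 + 2 ^- k.
  by apply: lim => // k; eexists; reflexivity.
have [y' hy] : exists x', forall k, 0 <= (s k).2 /\ (s k).2 <= x' <= (s k).2 + 2 ^- k.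
  by apply: lim => // k; eexists; reflexivity.
by exists x', y' => k; exists (s k).1, (s k).2; have [] := hx k; have [] := hy k.
Qed.

(** The Riemann sum of f along the segment from a to a + d, with 2 ^ N equal
    steps. Midpoints make it exact on affine functions, and subdividing a step
    is the same as halving the segment ([midsumS]): with these two properties
    the sums can replace integrals in the proof of Goursat's theorem. *)
Definition midsum (N : nat) (f : C -> C) (a d : C) : C :=
  \sum_(0 <= k < 2 ^ N) f (a + (2 * k%:R + 1) / 2 ^+ N.+1 * d) * (d / 2 ^+ N).

Lemma midsum0 f a d : midsum 0 f a d = f (a + d / 2) * d.
Proof.
by rewrite /midsum big_nat1 mulr0 add0r expr1 expr0 divr1 mul1r [2^-1 * _]mulrC.
Qed.

Lemma midsumS N f a d :
  midsum N.+1 f a d = midsum N f a (d / 2) + midsum N f (a + d / 2) (d / 2).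
Proof.
have two0 : (2 : C) != 0 by rewrite pnatr_eq0.
have p2 k : (2 : C) ^+ k != 0 by rewrite expf_neq0.
rewrite /midsum expnS mul2n -addnn (@big_cat_nat _ _ _ (2 ^ N)%N) ?leq_addr//=.
congr (_ + _).
  by apply: eq_bigr => k _; congr (f _ * _); rewrite !exprS; field; rewrite ?p2.
rewrite -{1}[(2 ^ N)%N]add0n big_addn addnK; apply: eq_bigr => k _.
rewrite natrD natrX !exprS; congr (f _ * _); field; by rewrite ?p2.
Qed.

Lemma midsum_le N f (a d : C) (K : R) :
  (forall t : R, 0 <= t <= 1 -> modulus (f (a + t%:C%C * d)) <= K) ->
  modulus (midsum N f a d) <= K * modulus d.
Proof.
elim: N a d => [|N IH] a d fK.
  rewrite midsum0 modulusM ler_wpM2r ?modulus_ge0//.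
  by have := fK 2^-1; rewrite -halfC mulrC; apply; lra.
rewrite midsumS (le_trans (modulusD _ _))//.
have dE : modulus d = modulus (d / 2) + modulus (d / 2).
  by rewrite modulusM halfC modulus_real//; field.
rewrite dE mulrDr lerD//; apply: IH => t t01.
  have -> : t%:C%C * (d / 2) = (t / 2)%:C%C * d by rewrite rmorphM/= halfC; ring.
  by apply: fK; lra.
have -> : a + d / 2 + t%:C%C * (d / 2) = a + ((t + 1) / 2)%:C%C * d.
  by rewrite rmorphM rmorphD/= halfC rmorph1; ring.
by apply: fK; lra.
Qed.

Lemma midsumB N f g (a d : C) :
  midsum N (fun z => f z - g z) a d = midsum N f a d - midsum N g a d.
Proof.
by rewrite /midsum -sumrB; apply: eq_bigr => k _; rewrite mulrBl.
Qed.

Lemma midsumD N f g (a d : C) :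
  midsum N (fun z => f z + g z) a d = midsum N f a d + midsum N g a d.
Proof.
by rewrite /midsum -big_split; apply: eq_bigr => k _; rewrite mulrDl.
Qed.

Lemma midsumZ N c f (a d : C) :
  midsum N (fun z => c * f z) a d = c * midsum N f a d.
Proof. by rewrite /midsum; under eq_bigr do rewrite -mulrA; rewrite -big_distrr. Qed.

Lemma midsum_affine N (A B a d : C) :
  midsum N (fun z => A + B * z) a d = A * d + B * (a * d + d ^+ 2 / 2).
Proof.
elim: N a d => [|N IH] a d; first by rewrite midsum0; field.
by rewrite midsumS !IH; field.
Qed.

Lemma eq_midsum N (f g : C -> C) (a d a' d' : C) :
  (forall t : C, f (a + t * d) * d = g (a' + t * d') * d') ->
  midsum N f a d = midsum N g a' d'.
Proof. by move=> fg; apply: eq_bigr => k _; rewrite !mulrA fg. Qed.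

Lemma midsum_real N (f : C -> C) (a d : C) (K : R) :
  (forall t : R, 0 <= t <= 1 ->
    exists2 r : R, K <= r & f (a + t%:C%C * d) = r%:C%C) ->
  exists2 r : R, K <= r & midsum N f a d = r%:C%C * d.
Proof.
elim: N a d => [|N IH] a d fK.
  have [|r Kr fE] := fK 2^-1; first by lra.
  by exists r => //; rewrite midsum0 -fE -halfC [2^-1 * _]mulrC.
have [|r1 K1 E1] := IH a (d / 2).
  move=> t t01; have [|r Kr fE] := fK (t / 2); first by lra.
  by exists r => //; rewrite -fE rmorphM/= halfC; congr f; ring.
have [|r2 K2 E2] := IH (a + d / 2) (d / 2).
  move=> t t01; have [|r Kr fE] := fK ((t + 1) / 2); first by lra.
  by exists r => //; rewrite -fE rmorphM rmorphD/= halfC rmorph1; congr f; ring.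
exists ((r1 + r2) / 2); first by lra.
by rewrite midsumS E1 E2 rmorphM rmorphD/= -halfC; ring.
Qed.

(** The sides of the square on h and i h, counterclockwise; the last two are
    run backwards, hence the signs. *)
Definition contour N (f : C -> C) (a h : C) : C :=
  midsum N f a h + midsum N f (a + h) (I * h)
  - midsum N f (a + I * h) h - midsum N f a (I * h).

(** The sides shared by two of the four quarters of the square cancel. *)
Lemma contourS N f (a h : C) : contour N.+1 f a h =
  contour N f a (h / 2) + contour N f (a + h / 2) (h / 2)
  + contour N f (a + I * (h / 2)) (h / 2)
  + contour N f (a + h / 2 + I * (h / 2)) (h / 2).
Proof.
rewrite /contour !midsumS.
have -> : I * h / 2 = I * (h / 2) by rewrite mulrA.
have e1 : a + h / 2 + h / 2 = a + h by field.
have e2 : a + I * (h / 2) + I * (h / 2) = a + I * h by field.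
rewrite e2 e1.
have -> : a + h / 2 + I * (h / 2) + h / 2 = a + h + I * (h / 2) by field.
have -> : a + h / 2 + I * (h / 2) + I * (h / 2) = a + I * h + h / 2 by field.
have -> : a + I * (h / 2) + h / 2 = a + h / 2 + I * (h / 2) by field.
ring.
Qed.

Lemma contourB N f g (a h : C) :
  contour N (fun z => f z - g z) a h = contour N f a h - contour N g a h.
Proof. by rewrite /contour !midsumB; ring. Qed.

Lemma contour_affine N (A B a h : C) : contour N (fun z => A + B * z) a h = 0.
Proof.
have II : I * I = -1 by rewrite -expr2 sqr_i.
rewrite /contour !midsum_affine.
rewrite (_ : _ - _ = B * ((I * h) ^+ 2 / 2 - (I * h) * h + h * (I * h)
                          - (I * h) ^+ 2 / 2)); last by ring.
by ring.
Qed.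

Definition in_square (a h z : C) := exists t u : R,
  [/\ 0 <= t <= 1, 0 <= u <= 1 & z = a + t%:C%C * h + u%:C%C * (I * h)].

Lemma contour_le N (f : C -> C) (a h : C) (K : R) :
  (forall z, in_square a h z -> modulus (f z) <= K) ->
  modulus (contour N f a h) <= 4 * K * modulus h.
Proof.
move=> fK.
have Ih : modulus (I * h) = modulus h by rewrite modulusM modulusI mul1r.
have z01 : (0:R) <= 0 <= (1:R) by lra.
have o01 : (0:R) <= 1 <= (1:R) by lra.
have b1 : modulus (midsum N f a h) <= K * modulus h.
  apply: midsum_le => t t01; apply: fK; exists t, 0; split => //.
  by rewrite rmorph0 mul0r addr0.
have b2 : modulus (midsum N f (a + h) (I * h)) <= K * modulus h.
  rewrite -[X in K * X]Ih; apply: midsum_le => t t01; apply: fK; exists 1, t; split => //.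
  by rewrite rmorph1 mul1r.
have b3 : modulus (midsum N f (a + I * h) h) <= K * modulus h.
  apply: midsum_le => t t01; apply: fK; exists t, 1; split => //.
  by rewrite rmorph1 mul1r addrAC.
have b4 : modulus (midsum N f a (I * h)) <= K * modulus h.
  rewrite -[X in K * X]Ih; apply: midsum_le => t t01; apply: fK; exists 0, t; split => //.
  by rewrite rmorph0 mul0r addr0.
rewrite /contour.
have := modulusB (midsum N f a h + midsum N f (a + h) (I * h)
  - midsum N f (a + I * h) h) (midsum N f a (I * h)).
have := modulusB (midsum N f a h + midsum N f (a + h) (I * h))
  (midsum N f (a + I * h) h).
have := modulusD (midsum N f a h) (midsum N f (a + h) (I * h)).
lra.
Qed.

End Sums.

Section Goursat.
Variable R : realType.
Local Notation C := (Cplx R).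
Local Notation I := ('i%C : C).

(** If the sums over a square exceed e times its area for arbitrarily fine steps,
    so do those over one of its quarters; the quarters shrink to a point, where
    differentiability contradicts this. At the origin f is only bounded, and an
    extra e is granted to the square that has the origin as a corner: exactly one
    of its quarters inherits it, so the grants add up. *)
Lemma goursat (f : C -> C) (M d : R) :
  (forall z, in_square 0 1 z -> z != 0 -> differentiable f z) ->
  0 < d -> (forall z, modulus z < d -> modulus (f z) <= M) ->
  forall e : R, 0 < e -> exists N0, forall N, (N0 <= N)%N ->
  modulus (contour N f 0 1) <= e.
Proof.
move=> df d0 fM e' e'0.
(* the unit square receives e for its area and e for its corner at the origin *)
pose e := e' / 2.
have e0 : 0 < e by rewrite /e; lra.
have p2 k : 0 < 2 ^- k :> R by rewrite invr_gt0 exprn_gt0.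
pose good k x y := exists N0, forall N, (N0 <= N)%N ->
  modulus (contour N f (of_parts x y) (2 ^- k)%:C%C)
    <= e * ((2 ^- k) ^+ 2 + ((x == 0) && (y == 0))%:R).
have [[N0 H]|ng0] := pselect (good 0%N 0 0).
  exists N0 => N /H; rewrite /of_parts !eqxx expr0 invr1 rmorph0 mulr0 add0r rmorph1.
  by move=> /le_trans; apply; rewrite /e expr1n/=; lra.
exfalso.
pose B k x y := [/\ ~ good k x y, 0 <= x /\ 0 <= y, x + 2 ^- k <= 1 & y + 2 ^- k <= 1].
have [||x' [y' H]] := @bisection R B.
- by split=> //; rewrite expr0 invr1 add0r.
- move=> k x y [ng [x00 y00] x1 y1]; apply/not_existsP => nB; apply: ng.
  have h2 : 2 ^- k = 2 ^- k.+1 + 2 ^- k.+1 :> R.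
    by rewrite exprS; field; rewrite expf_neq0// pnatr_eq0.
  have gd (b c : bool) : good k.+1 (x + b%:R / 2 ^+ k.+1) (y + c%:R / 2 ^+ k.+1).
    apply: contrapT => ng; apply: (nB b); exists c; split=> //.
      by split; rewrite addr_ge0// mulr_ge0// ?ler0n// ltW.
      by have := p2 k.+1; case: b {ng} => /=; rewrite ?mul1r ?mul0r; lra.
    by have := p2 k.+1; case: c {ng} => /=; rewrite ?mul1r ?mul0r; lra.
  have [N1 H1] := gd false false; have [N2 H2] := gd true false.
  have [N3 H3] := gd false true; have [N4 H4] := gd true true.
  exists (N1 + N2 + N3 + N4).+1 => -[//|N]; rewrite ltnS => NN.
  rewrite contourS.
  have -> : (2 ^- k)%:C%C / 2 = (2 ^- k.+1)%:C%C :> C.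
    by rewrite halfC -rmorphM exprS invfM mulrC.
  have := H1 N ltac:(lia); have := H2 N ltac:(lia).
  have := H3 N ltac:(lia); have := H4 N ltac:(lia).
  rewrite /= !mul0r !addr0 !mul1r {H1 H2 H3 H4 gd nB B ng0 good df fM}.
  set p := 2 ^- k.+1.
  have p0 : 0 < p by exact: p2.
  have px : 0 <= x -> x + p == 0 = false by move=> ?; apply/eqP; lra.
  have py : 0 <= y -> y + p == 0 = false by move=> ?; apply/eqP; lra.
  have -> : of_parts (x + p) y = of_parts x y + p%:C%C by rewrite /of_parts rmorphD/=; ring.
  have -> : of_parts x (y + p) = of_parts x y + I * p%:C%C.
    by rewrite /of_parts rmorphD/=; ring.
  have -> : of_parts (x + p) (y + p) = of_parts x y + p%:C%C + I * p%:C%C.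
    by rewrite /of_parts !rmorphD/=; ring.
  rewrite px// py// ?andbF ?andFb ?addr0.
  set c1 := contour _ _ _ _; set c2 := contour _ _ _ _.
  set c3 := contour _ _ _ _; set c4 := contour _ _ _ _.
  have := modulusD (c4 + c3 + c2) c1; have := modulusD (c4 + c3) c2.
  have := modulusD c4 c3; rewrite h2 -/p; move: c1 c2 c3 c4 => c1 c2 c3 c4.
  set fl : R := ((x == 0) && (y == 0))%:R.
  lra.
have x0 : 0 <= x' <= 1 /\ 0 <= y' <= 1.
  have [x [y [[_ _ x1 y1] x0 xx y0 yy]]] := H 0%N.
  by move: x1 y1 xx yy; rewrite expr0 invr1; lra.
have Hin k x y z : x <= x' <= x + 2 ^- k -> y <= y' <= y + 2 ^- k ->
  in_square (of_parts x y) (2 ^- k)%:C%C z -> modulus (z - of_parts x' y') <= 2 * 2 ^- k.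
  move=> xx yy [t [u [t01 u01 ->]]].
  rewrite (_ : _ - _ = of_parts (x + t * 2 ^- k - x') (y + u * 2 ^- k - y')).
    apply: le_trans (modulus_of_parts _ _) _.
    rewrite mulrDl mul1r lerD// ler_norml; have := p2 k; nra.
  by rewrite /of_parts !(rmorphD, rmorphB, rmorphM, rmorphN)/=; ring.
have [/eqP z0|z0] := boolP (of_parts x' y' == 0).
  have [x'0 y'0] := of_parts_eq0 z0.
  have M0 : 0 <= M.
    by apply: le_trans (fM 0 _); rewrite ?modulus_ge0// modulus0.
  have [|k kd] := @exp2_lt R (Num.min (d / 2) (e / (4 * M + 1))).
    by rewrite lt_min !divr_gt0//; lra.
  have [x [y [[ng _ _ _] x0' xx y0' yy]]] := H k.
  apply: ng; exists 0%N => N _.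
  have [x00 y00] : x = 0 /\ y = 0 by lra.
  move: kd; rewrite lt_min => /andP[kd]; rewrite ltr_pdivlMr; last by lra.
  move=> ke.
  apply: (le_trans (@contour_le _ _ _ _ _ M _)).
    move=> z /(Hin _ _ _ _ xx yy); rewrite z0 subr0 => zk.
    by apply: fM; lra.
  rewrite modulus_real ?(ltW (p2 k))// x00 y00 eqxx/=; have := p2 k; nra.
have inz : in_square 0 1 (of_parts x' y').
  exists x', y'; split; [tauto|tauto|]; rewrite /of_parts; ring.
have HL := differentiable_approx (df (of_parts x' y') inz z0).
set L := 'D_1 f (of_parts x' y') in HL.
(* the points of a square of side s are within 2 s of the limit point, and its
   boundary has length 4 s *)
have e8 : 0 < e / 8 by lra.
have [d' d'0 Hd] := HL _ e8.
have [k kd] := @exp2_lt R (d' / 2) ltac:(lra).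
have [x [y [[ng _ _ _] x0' xx y0' yy]]] := H k.
apply: ng; exists 0%N => N _.
have -> : contour N f (of_parts x y) (2 ^- k)%:C%C =
    contour N (fun z => f z - ((f (of_parts x' y') - L * of_parts x' y') + L * z))
      (of_parts x y) (2 ^- k)%:C%C.
  by rewrite contourB contour_affine subr0.
apply: (le_trans (@contour_le _ _ _ _ _ (e / 8 * (2 * 2 ^- k)) _)).
  move=> z /(Hin _ _ _ _ xx yy) zk.
  have -> : f z - (f (of_parts x' y') - L * of_parts x' y' + L * z) =
    f z - f (of_parts x' y') - L * (z - of_parts x' y') by ring.
  apply: (le_trans (Hd _ _)); first by lra.
  by rewrite ler_wpM2l// ltW.
rewrite modulus_real ?(ltW (p2 k))//.
have : 0 <= ((x == 0) && (y == 0))%:R :> R by rewrite ler0n.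
set p := 2 ^- k => /(mulr_ge0 (ltW e0)) flE.
have -> : 4 * (e / 8 * (2 * p)) * p = e * p ^+ 2 by field.
by rewrite mulrDr lerDl.
Qed.

End Goursat.

(** * The maximum principle *)

Section MeanValue.
Variable R : realType.
Local Notation C := (Cplx R).
Local Notation I := ('i%C : C).

(** An inequality known up to a constant factor, once applied to all powers,
    holds without the factor. *)
Lemma expr_bounded_le (x m c : R) : 0 <= m ->
  (forall n, x ^+ n.+1 <= c * m ^+ n.+1) -> x <= m.
Proof.
move=> m0 H; rewrite leNgt; apply/negP => mx.
have [m00|mp] := eqVneq m 0.
  by have := H 0%N; rewrite !expr1 m00 mulr0; lra.
have {mp}m0 : 0 < m by rewrite lt_neqAle eq_sym mp.
pose d := x / m - 1.
have d0 : 0 < d by rewrite subr_gt0 ltr_pdivlMr// mul1r.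
have B n : 1 + n%:R * d <= (1 + d) ^+ n.
  elim: n => [|n IH]; first by rewrite mul0r addr0.
  rewrite exprS -natr1; have : 0 <= n%:R :> R by []; nra.
have dE : 1 + d = x / m by rewrite /d; ring.
pose n := Num.truncn (c / d).
have nd : c < n.+1%:R * d by rewrite -ltr_pdivrMr// truncnS_gt.
have := H n; have := B n.+1; rewrite dE expr_div_n ler_pdivlMr ?exprn_gt0//.
have : 0 < m ^+ n.+1 by rewrite exprn_gt0.
nra.
Qed.

(** The sum F of f over the rotations by I satisfies F (I z) = F z, so in the
    contour sum of (F z - F 0) / z over the unit square the two sides through 0
    cancel. On the other two sides, where 1 <= |z| <= 2, the terms F z / z are
    bounded by the values of f, while the terms 1 / z add up to a multiple of I
    of modulus at least one. *)
Lemma mean_bound (f : C -> C) (m : R) :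
  (forall z, modulus z <= 2 -> differentiable f z) ->
  (forall z, 1 <= modulus z <= 2 -> modulus (f z) <= m) ->
  modulus (f 0) <= 2 * m.
Proof.
move=> df fm.
have II : I * I = -1 by rewrite -expr2 sqr_i.
have I0 : I != 0 by rewrite -modulus_eq0 modulusI oner_eq0.
pose F z := f z + f (I * z) + f (- z) + f (- (I * z)).
have FI z : F (I * z) = F z.
  by rewrite /F mulrA II !mulN1r opprK; ring.
have dF z : modulus z <= 2 -> differentiable F z.
  move=> z2.
  have aux a : modulus a = 1 -> differentiable (fun w => f (a * w)) z.
    move=> a1; have := @differentiable_scale R f a 0 z; rewrite add0r => /(_ _).
    rewrite (_ : (fun w => f (0 + a * w)) = (fun w => f (a * w))); last first.
      by apply/funext => w; rewrite add0r.
    by apply; apply: df; rewrite modulusM a1 mul1r.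
  rewrite (_ : F =
    fun w => f (1 * w) + f (I * w) + f ((-1) * w) + f ((- I) * w)); last first.
    by apply/funext => w; rewrite /F mul1r mulN1r mulNr.
  apply: differentiableD; last by apply: aux; rewrite modulusN modulusI.
  apply: differentiableD; last by apply: aux; rewrite modulusN modulus1.
  by apply: differentiableD; apply: aux; rewrite ?modulusI ?modulus1.
have Fm z : 1 <= modulus z <= 2 -> modulus (F z) <= 4 * m.
  move=> z12; have := fm z z12.
  have : modulus (f (I * z)) <= m by apply: fm; rewrite modulusM modulusI mul1r.
  have : modulus (f (- z)) <= m by apply: fm; rewrite modulusN.
  have : modulus (f (- (I * z))) <= m.
    by apply: fm; rewrite modulusN modulusM modulusI mul1r.
  rewrite /F.
  have := modulusD (f z + f (I * z) + f (- z)) (f (- (I * z))).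
  have := modulusD (f z + f (I * z)) (f (- z)).
  have := modulusD (f z) (f (I * z)).
  lra.
pose G z := (F z - F 0) / z.
have GI z : G (I * z) * I = G z.
  rewrite /G FI; have [->|z0] := eqVneq z 0; first by rewrite mulr0 !invr0 !mulr0 mul0r.
  by field; rewrite I0 z0.
have dF0 : differentiable F 0 by apply: dF; rewrite modulus0; lra.
have [d d0 Hd] := differentiable_approx dF0 ltr01.
set L := 'D_1 F 0 in Hd.
have Gbd z : modulus z < d -> modulus (G z) <= modulus L + 1.
  move=> zd; have [->|z0] := eqVneq z 0.
    by rewrite /G invr0 mulr0 modulus0 addr_ge0// modulus_ge0.
  have := Hd z; rewrite subr0 mul1r => /(_ zd) H.
  have zm : 0 < modulus z by rewrite modulus_gt0.
  rewrite /G modulusM modulusV ler_pdivrMr//.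
  have -> : F z - F 0 = (F z - F 0 - L * z) + L * z by ring.
  by rewrite (le_trans (modulusD _ _))// modulusM; lra.
have dG z : in_square 0 1 z -> z != 0 -> differentiable G z.
  move=> [t [u [t01 u01 zE]]] z0.
  have z2 : modulus z <= 2.
    have -> : z = of_parts t u by rewrite zE /of_parts; ring.
    by rewrite (le_trans (modulus_of_parts _ _))// !ger0_norm//; lra.
  have -> : G = (F - cst (F 0)) * (fun w => w^-1) by [].
  apply: differentiableM; last exact: (differentiable_Rinv z0).
  by apply: differentiableB; [exact: (dF z z2)|exact: differentiable_cst].
rewrite leNgt; apply/negP => mlt.
pose e := modulus (f 0) - 2 * m.
have [|N0 HN] := goursat dG d0 Gbd (e := e); first by rewrite /e; lra.
have := HN N0 (leqnn _); rewrite /contour !add0r !mulr1.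
(* the two sides through 0 cancel *)
have -> : midsum N0 G 0 I = midsum N0 G 0 1.
  by apply: eq_midsum => t; rewrite !add0r !mulr1 mulrC [t * I]mulrC mulrC GI.
(* the rotation by I turns the top side into the lower half of the right side
   of the square of centre 0 *)
have -> : midsum N0 G I 1 = - midsum N0 (fun z => G (2 - z)) 1 I.
  rewrite -mulN1r -midsumZ; apply: eq_midsum => t; rewrite !mulr1.
  have -> : I + t = I * (2 - (1 + t * I)).
    rewrite (_ : I * (2 - (1 + t * I)) = I - (I * I) * t); last by ring.
    by rewrite II; ring.
  set w := 2 - _; rewrite -(GI w) -mulrA -mulrA II; ring.
rewrite (_ : _ - _ = midsum N0 (fun z => G z + G (2 - z)) 1 I); last first.
  by rewrite midsumD; ring.
(* the weight of F 0, real on the right side, where z and 2 - z are conjugate *)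
pose k z : C := z^-1 + (2 - z)^-1.
rewrite (_ : midsum _ _ _ _ = midsum N0 (fun z => F z / z + F (2 - z) / (2 - z)) 1 I
   - F 0 * midsum N0 k 1 I); last first.
  by rewrite -midsumZ -midsumB; congr midsum; apply/funext => z; rewrite /G /k; ring.
have cE (t : R) : 1 + t%:C%C * I = of_parts 1 t by rewrite /of_parts rmorph1 mulrC.
have cE' (t : R) : 2 - (1 + t%:C%C * I) = of_parts 1 (- t).
  by rewrite /of_parts rmorph1 rmorphN; ring.
set S1 := midsum _ _ _ _ => Hlow.
have S1m : modulus S1 <= 8 * m.
  have -> : 8 * m = 8 * m * modulus I by rewrite modulusI mulr1.
  apply: midsum_le => t t01; rewrite cE' cE.
  have aux (s : R) : -1 <= s <= 1 -> modulus (F (of_parts 1 s) / of_parts 1 s) <= 4 * m.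
    move=> /modulus_of_parts1 /andP[s1 s2].
    have FM := Fm (of_parts 1 s); rewrite s1 s2 in FM.
    rewrite modulusM modulusV ler_pdivrMr; last by lra.
    apply: (le_trans (FM isT)); rewrite ler_peMr//.
    by apply: le_trans (FM isT); exact: modulus_ge0.
  have := aux t ltac:(lra); have := aux (- t) ltac:(lra).
  have := modulusD (F (of_parts 1 t) / of_parts 1 t) (F (of_parts 1 (- t)) / of_parts 1 (- t)).
  lra.
have [|r r1 rE] := @midsum_real R N0 k 1 I 1.
  move=> t t01; rewrite /k cE' cE; exists (2 / (1 + t ^+ 2)).
    by rewrite ler_pdivlMr; nra.
  have n0 s : of_parts 1 s != 0.
    by apply/eqP => /of_parts_eq0[/eqP]; rewrite oner_eq0.
  have -> : (2 / (1 + t ^+ 2))%:C%C = 2 / (of_parts 1 t * of_parts 1 (- t)) :> C.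
    rewrite rmorphM/= rmorph_nat fmorphV; congr (_ / _).
    rewrite rmorphD rmorph1 rmorphXn/= /of_parts rmorph1 rmorphN.
    rewrite (_ : (1 + _) * _ = 1 - (I * I) * t%:C%C ^+ 2); last by ring.
    by rewrite II; ring.
  have -> : 2 = of_parts 1 t + of_parts 1 (- t) :> C.
    by rewrite /of_parts rmorph1 rmorphN; ring.
  by field; rewrite !n0.
have F0 : F 0 = 4 * f 0 by rewrite /F mulr0 oppr0; ring.
have := modulusB S1 (S1 - F 0 * midsum N0 k 1 I).
rewrite opprB addrC subrK rE F0 !modulusM modulusI modulus_nat modulus_real; last by lra.
move: Hlow; rewrite rE F0 => Hlow.
have := modulus_ge0 (f 0); rewrite /e in Hlow; nra.
Qed.

Lemma center_le_annulus (f : C -> C) (c : C) (r m : R) : 0 < r ->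
  (forall z, modulus (z - c) <= 2 * r -> differentiable f z) ->
  (forall z, r <= modulus (z - c) <= 2 * r -> modulus (f z) <= m) ->
  modulus (f c) <= m.
Proof.
move=> r0 df fm.
have rm : modulus (r%:C%C : C) = r by rewrite modulus_real// ltW.
have m0 : 0 <= m.
  apply: le_trans (modulus_ge0 (f (c + r%:C%C))) (fm _ _).
  by rewrite addrAC subrr add0r rm; lra.
apply: (@expr_bounded_le _ _ 2) => // n.
have := @mean_bound (fun z => f (c + r%:C%C * z) ^+ n.+1) (m ^+ n.+1).
rewrite mulr0 addr0 modulusX; apply => z.
  move=> z2; have -> : (fun z => f (c + r%:C%C * z) ^+ n.+1) =
      (fun z => f (c + r%:C%C * z)) ^+ n.+1.
    by apply/funext => w; rewrite exprfctE.
  apply: differentiableX; apply: differentiable_scale; apply: df.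
  by rewrite addrAC subrr add0r modulusM rm mulrC ler_wpM2r// ltW.
move=> /andP[z1 z2]; rewrite modulusX lerXn2r ?nnegrE ?modulus_ge0//.
apply: fm; rewrite addrAC subrr add0r modulusM rm; nra.
Qed.

End MeanValue.

Section MaximumPrinciple.
Variable R : realType.
Local Notation C := (Cplx R).

(** For n large |f ^ n k| < M ^ n on the annulus, uniformly by compactness: where
    |k| < 1 because |f| <= M, and elsewhere because |f| < M. As |f ^ n k| is at
    least M ^ n at the centre b, this contradicts [center_le_annulus]. *)
Lemma barrier (f k : C -> C) (b : C) (r M : R) : 0 < r -> 0 < M ->
  (forall z, modulus (z - b) <= 2 * r -> differentiable f z) ->
  (forall z, modulus (z - b) <= 2 * r -> differentiable k z) ->
  (forall z, modulus (z - b) <= 2 * r -> modulus (f z) <= M) ->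
  M <= modulus (f b) -> 1 <= modulus (k b) ->
  (forall z, r <= modulus (z - b) <= 2 * r -> modulus (f z) < M \/ modulus (k z) < 1) ->
  False.
Proof.
move=> r0 M0 df dk fM fb kb fk.
pose A := disc b (2 * r) `&` [set z | r <= modulus (z - b)].
have AE z : A z -> r <= modulus (z - b) <= 2 * r by move=> [/= ? ?]; apply/andP.
have cA : compact A.
  apply: (@subclosed_compact _ _ _ _ (@compact_disc R b (2 * r))); last by move=> z [].
  by apply: closedI; [exact: closed_disc|exact: closed_codisc].
have A0 : A !=set0.
  exists (b + r%:C%C); rewrite /A /disc /= addrAC subrr add0r.
  by rewrite modulus_real; [split; lra|exact: ltW].
have [bk Abk Hk] := modulus_max cA A0 (fun z Az => dk z Az.1).
(* w is positive, hence bounded below on the annulus by some e > 0; so at each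
   point |f| or |k| is below its bound by at least e / 2 *)
pose w z := M - modulus (f z) + Num.max 0 (1 - modulus (k z)).
have wc z : A z -> {for z, continuous w}.
  move=> Az.
  have mc (g : C -> C) (x : R) : differentiable g z ->
      {for z, continuous (fun y => x - modulus (g y))}.
    move=> dg; apply: (@continuousB _ _ _ (cst x) (fun y => modulus (g y)) z).
      exact: cst_continuous.
    exact: differentiable_modulus_continuous.
  apply: (@continuousD _ _ _ (fun y => M - modulus (f y))).
    by apply: mc; exact: df Az.1.
  apply: (@continuous_max R C (cst 0) (fun y => 1 - modulus (k y))).
    exact: cst_continuous.
  by apply: mc; exact: dk Az.1.
have [|bw /set_mem Abw wm] := @compact_EVT_min _ _ w A A0 cA.
  by apply: continuous_in_subspaceT => z /set_mem/wc.
pose e := w bw.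
have e0 : 0 < e.
  have := fM _ Abw.1; have := fk _ (AE _ Abw); rewrite /e /w.
  have : 0 <= Num.max 0 (1 - modulus (k bw)) by rewrite le_max lexx.
  have : 1 - modulus (k bw) <= Num.max 0 (1 - modulus (k bw)).
    by rewrite le_max lexx orbT.
  by move=> ? ? []; lra.
have we z : A z -> modulus (f z) <= M - e / 2 \/ modulus (k z) <= 1 - e / 2.
  move=> Az; have := wm z (mem_set Az); rewrite -/e /w.
  by rewrite maxEle; case: ifP => _ h;
    case: (leP (modulus (f z)) (M - e / 2)) => ?; [left|right|left|right]; lra.
pose K := modulus (k bk).
have K0 : 0 <= K by exact: modulus_ge0.
(* otherwise M ^ n <= 2 K (M - e / 2) ^ n for all n *)
have [n Hn] : exists n,
    A !=set0 -> (Num.max 0 (M - e / 2)) ^+ n.+1 * K <= M ^+ n.+1 / 2.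
  apply: contrapT => /forallNP nH.
  have : M <= Num.max 0 (M - e / 2).
    apply: (@expr_bounded_le _ _ _ (2 * K)); first by rewrite le_max lexx.
    move=> n; have /not_implyP[_ /negP] := nH n; rewrite -ltNge; lra.
  by rewrite le_max; lra.
pose e' := Num.min (1 / 2) (e / 2).
have := @center_le_annulus R (fun z => f z ^+ n.+1 * k z) b r (M ^+ n.+1 * (1 - e')) r0.
have M1 : 0 < M ^+ n.+1 by rewrite exprn_gt0.
have e'0 : 0 < e' by rewrite lt_min; lra.
have e'1 : e' <= 1 / 2 by rewrite ge_min lexx.
have e'2 : e' <= e / 2 by rewrite ge_min lexx orbT.
move=> H; have {H} : modulus (f b ^+ n.+1 * k b) <= M ^+ n.+1 * (1 - e').
  apply: H.
    move=> z zr; have -> : (fun z => f z ^+ n.+1 * k z) = (f ^+ n.+1) * k.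
      by apply/funext => y; rewrite /= fctE exprfctE.
    by apply: differentiableM; [apply: differentiableX; exact: df|exact: dk].
  move=> z /andP[zr z2r]; have Az : A z by split.
  rewrite modulusM modulusX.
  have [fz|kz] := we z Az.
    apply: (@le_trans _ _ (Num.max 0 (M - e / 2) ^+ n.+1 * K)).
      rewrite ler_pM ?exprn_ge0 ?modulus_ge0 ?Hk// lerXn2r ?nnegrE ?modulus_ge0//.
        by rewrite le_max lexx.
      by rewrite le_max fz orbT.
    by apply: (le_trans (Hn A0)); nra.
  rewrite ler_pM ?exprn_ge0 ?modulus_ge0//; last by lra.
  by rewrite lerXn2r ?nnegrE ?modulus_ge0// ?(ltW M0)// fM.
rewrite modulusM modulusX.
have : M ^+ n.+1 <= modulus (f b) ^+ n.+1.
  by rewrite lerXn2r ?nnegrE ?modulus_ge0// (ltW M0).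
have := modulus_ge0 (k b); nra.
Qed.

(** Otherwise let b be, among the points where |f| is maximal, one at greatest
    distance from c. The disc of centre 2 c - b through b contains the others in
    its interior, so the affine function k that vanishes at this centre and
    equals 1 at b is a barrier at b. *)
Lemma max_modulus_disc (f : C -> C) (c : C) (r m : R) : 0 < r ->
  (forall z, modulus (z - c) <= r -> differentiable f z) ->
  (forall z, modulus (z - c) = r -> modulus (f z) <= m) ->
  forall z, modulus (z - c) <= r -> modulus (f z) <= m.
Proof.
move=> r0 df fm z0 z0r.
have m0 : 0 <= m.
  apply: le_trans (modulus_ge0 (f (c + r%:C%C))) (fm _ _).
  by rewrite addrAC subrr add0r modulus_real// ltW.
have [|b0 b0r b0m] := modulus_max (@compact_disc R c r) _ df.
  by exists c; rewrite /disc /= subrr modulus0 ltW.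
apply: le_trans (b0m _ z0r) _; rewrite leNgt; apply/negP.
set M := modulus (f b0) => mM.
pose K := disc c r `&` [set z | M <= modulus (f z)].
have cK : compact K.
  apply: (@subclosed_compact _ _ _ _ (@compact_disc R c r)); last by move=> z [].
  move=> z clz; have zr : disc c r z.
    by apply: (closed_disc (c:=c) (r:=r)) => B /clz [w [[]]]; exists w.
  split=> //=; rewrite leNgt; apply/negP => zM.
  have /clz[w [[_ /=]]] : nbhs z [set w | modulus (f w) < M].
    have /= := differentiable_modulus_continuous (df z zr).
    move=> /(_ [set x | x < M]); apply.
    exact: open_nbhs_nbhs.
  by rewrite leNgt => /negP.
have [||b /set_mem Kb bm] := @compact_EVT_max _ _ (fun z => modulus (z - c)) K _ cK.
- by exists b0; split => //=.
- by apply: continuous_subspaceT => z; exact: continuous_modulus_sub.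
have [br Mb] := Kb.
have br' : modulus (b - c) < r.
  rewrite lt_neqAle br andbT; apply/eqP => /fm h; move: Mb => /= h'; lra.
pose rho := (r - modulus (b - c)) / 2.
have rho0 : 0 < rho by rewrite /rho; lra.
have inr z : modulus (z - b) <= 2 * rho -> disc c r z.
  have := modulusD (z - b) (b - c); rewrite addrA subrK /disc /rho /=; lra.
(* b = c only if c is the unique point of K, and then no pushing is necessary *)
pose k z := if b == c then 1 else (z - c + (b - c)) / (2 * (b - c)).
apply: (@barrier f k b (rho / 2) M).
- by rewrite /rho; lra.
- lra.
- by move=> z zr; apply: df; apply: inr; lra.
- move=> z zr; rewrite /k; case: eqVneq => _; first exact: differentiable_cst.
  rewrite (_ : (fun z => _) =
      (fun w => id (- (c - (b - c)) / (2 * (b - c)) + (2 * (b - c))^-1 * w))).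
    by apply: (@differentiable_scale R id); exact: ex_diff.
  by apply/funext => w /=; ring.
- by move=> z zr; apply: b0m; apply: inr; lra.
- exact: Mb.
- rewrite /k; case: eqVneq => [_|bc]; first by rewrite modulus1.
  rewrite (_ : b - c + (b - c) = 2 * (b - c)); last by ring.
  by rewrite divff ?modulus1// mulf_neq0 ?pnatr_eq0// subr_eq0.
move=> z /andP[zr1 zr2].
have [fz|fz] := ltP (modulus (f z)) M; [by left|right].
have zb : modulus (z - c) <= modulus (b - c).
  by apply: bm; apply/mem_set; split; [apply: inr; lra|].
have P := parallelogram (z - c) (b - c).
have zcb : (z - c) - (b - c) = z - b by ring.
have zb0 : 0 < modulus (z - b) by rewrite /rho in zr1; lra.
have [zc0 bc0] := (modulus_ge0 (z - c), modulus_ge0 (b - c)).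
rewrite zcb in P.
have lt : modulus (z - c + (b - c)) < 2 * modulus (b - c).
  rewrite -ltr_sqr ?nnegrE ?modulus_ge0//; last by lra.
  nra.
rewrite /k; case: eqVneq lt => [->|bc lt].
  by rewrite subrr modulus0 mulr0 ltNge modulus_ge0.
rewrite modulusM modulusV modulusM modulus_nat ltr_pdivrMr ?mul1r//.
by rewrite mulr_gt0// modulus_gt0 subr_eq0.
Qed.

End MaximumPrinciple.

(** * The Schwarz lemma and its consequences *)

Section Schwarz.
Variable R : realType.
Local Notation C := (Cplx R).

(** The function v ^ (n+1) / (z - c) ^ n is differentiable at c because v / (z - c)
    has a limit there. The maximum principle applies to it, and taking (n+1)-th
    roots loses nothing as n grows. *)
Lemma schwarz (v : C -> C) (c : C) (r M : R) : 0 < r ->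
  (forall z, modulus (z - c) <= r -> differentiable v z) ->
  v c = 0 ->
  (forall z, modulus (z - c) = r -> modulus (v z) <= M) ->
  forall z, modulus (z - c) <= r -> modulus (v z) <= M / r * modulus (z - c).
Proof.
move=> r0 dv v0 vM z zr.
have [->|zc] := eqVneq z c; first by rewrite v0 subrr !modulus0 mulr0.
have zc0 : 0 < modulus (z - c).
  by rewrite modulus_gt0 subr_eq0.
have M0 : 0 <= M.
  apply: le_trans (modulus_ge0 (v (c + r%:C%C))) (vM _ _).
  by rewrite addrAC subrr add0r modulus_real// ltW.
apply: (@expr_bounded_le _ _ _ (r / modulus (z - c))).
  by rewrite mulr_ge0 ?divr_ge0 ?(ltW r0) ?(ltW zc0).
move=> n.
pose q w := v w / (w - c).
have dq w : modulus (w - c) <= r -> w != c -> differentiable q w.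
  move=> wr wc; have -> : q = v * (fun w => (w - c)^-1) by [].
  apply: differentiableM; first exact: dv _ wr.
  by apply: differentiableV; [exact: differentiable_subc|rewrite subr_eq0].
pose u w := v w * q w ^+ n.
have du w : modulus (w - c) <= r -> differentiable u w.
  move=> wr; have [->{w wr}|wc] := eqVneq w c; last first.
    have -> : u = v * q ^+ n by apply/funext => y; rewrite /= fctE exprfctE.
    apply: differentiableM; first exact: dv _ wr.
    by apply: differentiable_exp; exact: dq _ wr wc.
  apply/derivable1_diffP; rewrite /derivable.
  have dvc : derivable v c 1.
    by apply/derivable1_diffP/dv; rewrite subrr modulus0 ltW.
  (* at c the derivative of u is the power of that of v *)
  suff : (fun h : C => (h^-1 *: ((v \o shift c) h%:A - v c)) ^+ n.+1) @ 0^'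
      --> ('D_1 v c) ^+ n.+1.
    move=> H; apply/cvg_ex; exists ('D_1 v c ^+ n.+1).
    apply: cvg_trans H; apply: near_eq_cvg.
    near=> h; rewrite /= v0 /u v0 mul0r !subr0 /q.
    have -> : h%:A = h by rewrite /GRing.scale /= mulr1.
    rewrite addrK /GRing.scale /= [h^-1 * v _]mulrC exprS.
    by set P := _ ^+ n; ring.
  apply: (@cvg_comp _ _ _ (fun h : C => h^-1 *: ((v \o shift c) h%:A - v c))
    (fun x : C => x ^+ n.+1) _ (nbhs ('D_1 v c))).
    exact: dvc.
  rewrite (_ : (fun x : C => x ^+ n.+1) = (id : C -> C) ^+ n.+1).
    have di : differentiable (id : C -> C) ('D_1 v c) by exact: ex_diff.
    have := differentiable_continuous (differentiable_exp n.+1 di).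
    by rewrite /continuous_at exprfctE.
  by apply/funext => x; rewrite exprfctE.
have mu w : modulus (w - c) = r -> modulus (u w) <= M ^+ n.+1 / r ^+ n.
  move=> wr; rewrite /u /q modulusM modulusX modulusM modulusV wr.
  rewrite expr_div_n mulrA ler_wpM2r ?invr_ge0 ?exprn_ge0 ?(ltW r0)// -exprS.
  by rewrite lerXn2r ?nnegrE ?modulus_ge0// vM.
have := max_modulus_disc r0 du mu zr.
rewrite /u /q modulusM modulusX modulusM modulusV expr_div_n mulrA -exprS.
rewrite ler_pdivrMr ?exprn_gt0// => /le_trans; apply.
rewrite exprMn expr_div_n.
have rn k : r ^+ k != 0 by rewrite expf_neq0// gt_eqF.
rewrite le_eqVlt; apply/orP; left; apply/eqP.
by rewrite !exprS; field; rewrite rn !gt_eqF.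
Unshelve. all: by end_near. Qed.

(** The real part of u = 1 - f / f c is nonnegative, so for A > 0 the function
    u / (u + 2 A) is bounded by one; it vanishes at c. The Schwarz lemma bounds
    |u| by a multiple of A, and A is arbitrary. *)
Lemma strong_maximum (f : C -> C) (c : C) (r : R) :
  (forall z, modulus (z - c) <= r -> differentiable f z) ->
  (forall z, modulus (z - c) <= r -> modulus (f z) <= modulus (f c)) ->
  forall z, modulus (z - c) < r -> f z = f c.
Proof.
move=> df fM z zr.
have r0 : 0 < r by apply: le_lt_trans zr; exact: modulus_ge0.
have cr : modulus (c - c) <= r by rewrite subrr modulus0 ltW.
have [fc0|fc0] := eqVneq (f c) 0.
  apply/eqP; rewrite fc0 -modulus_eq0 eq_le modulus_ge0 andbT.
  by have := fM z (ltW zr); rewrite fc0 modulus0.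
pose u z := 1 - f z / f c.
have mfc : 0 < modulus (f c) by rewrite modulus_gt0.
have Reu w : modulus (w - c) <= r -> 0 <= complex.Re (u w).
  move=> wr; have : modulus (f w / f c) <= 1.
    by rewrite modulusM modulusV ler_pdivrMr// mul1r fM.
  have := modulus_Re (f w / f c); rewrite /u raddfB /= ler_norml; lra.
have mA w (A : R) : modulus (w - c) <= r -> 0 < A ->
    modulus (u w) < modulus (u w + (2 * A)%:C%C).
  move=> /Reu; case: (u w) => x y /= x0 A0.
  rewrite /modulus /= ltr_sqrt; first by rewrite addr0; nra.
  by rewrite addr0; nra.
have du w : modulus (w - c) <= r -> differentiable u w.
  move=> wr; have -> : u = cst 1 - (f * cst (f c)^-1) by [].
  apply: differentiableB; first exact: differentiable_cst.
  by apply: differentiableM; [exact: df _ wr|exact: differentiable_cst].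
have key (A : R) : 0 < A -> modulus (u z) * (r - modulus (z - c)) <= 2 * A * r.
  move=> A0; pose v w := u w / (u w + (2 * A)%:C%C).
  have ne w : modulus (w - c) <= r -> u w + (2 * A)%:C%C != 0.
    move=> wr; rewrite -modulus_eq0 gt_eqF//.
    by apply: le_lt_trans (mA _ _ wr A0); exact: modulus_ge0.
  have : modulus (v z) <= 1 / r * modulus (z - c).
    apply: (@schwarz v c r 1 r0 _ _ _ z (ltW zr)).
    - move=> w wr; have -> : v = u * (fun w => (u w + (2 * A)%:C%C)^-1) by [].
      apply: differentiableM; first exact: du _ wr.
      apply: differentiableV; last exact: ne _ wr.
      by apply: differentiableD; [exact: du _ wr|exact: differentiable_cst].
    - by rewrite /v /u divff// subrr mul0r.
    - move=> w wr; have wr' : modulus (w - c) <= r by rewrite wr.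
      rewrite /v modulusM modulusV ler_pdivrMr ?mul1r ?(ltW (mA _ _ wr' A0))//.
      by rewrite modulus_gt0 ne.
  have ne0 : 0 < modulus (u z + (2 * A)%:C%C).
    by rewrite modulus_gt0 ne// ltW.
  rewrite /v modulusM modulusV ler_pdivrMr// mul1r => h.
  have : modulus (u z) * r <= modulus (z - c) * modulus (u z + (2 * A)%:C%C).
    rewrite -ler_pdivlMr//; apply: (le_trans h).
    by rewrite le_eqVlt; apply/orP; left; apply/eqP; ring.
  have := modulusD (u z) (2 * A)%:C%C.
  rewrite modulus_real; last by lra.
  have := modulus_ge0 (z - c).
  nra.
have uz0 : modulus (u z) = 0.
  apply/eqP; rewrite eq_le modulus_ge0 andbT leNgt; apply/negP => u0.
  pose P := modulus (u z) * (r - modulus (z - c)).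
  have P0 : 0 < P by rewrite mulr_gt0 ?subr_gt0.
  have := key (P / (4 * r)) (divr_gt0 P0 (mulr_gt0 (ltr0n _ 4) r0)); rewrite -/P.
  have -> : 2 * (P / (4 * r)) * r = P / 2 by field; rewrite gt_eqF.
  by lra.
move/eqP: uz0; rewrite modulus_eq0 /u subr_eq0 => /eqP e1.
by rewrite -[f z](divfK fc0) -e1 mul1r.
Qed.

(** All the quotients f / (z - c) ^ n are differentiable, so by the maximum
    principle |f z| <= M (|z - c| / r) ^ n for every n. *)
Lemma identity_disc (f : C -> C) (c : C) (r d : R) : 0 < d ->
  (forall z, modulus (z - c) <= r -> differentiable f z) ->
  (forall z, modulus (z - c) < d -> f z = 0) ->
  forall z, modulus (z - c) < r -> f z = 0.
Proof.
move=> d0 df f0 z zr.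
have r0 : 0 < r by apply: le_lt_trans zr; exact: modulus_ge0.
have [||b _ bM] := @modulus_max R f (disc c r) (@compact_disc R c r) _ _.
- by exists c; rewrite /disc/= subrr modulus0 ltW.
- exact: df.
have [zd|zd] := ltP (modulus (z - c)) d; first exact: f0.
set M := modulus (f b) in bM.
have zc0 : 0 < modulus (z - c) by lra.
have gb n : modulus (f z) <= M * (modulus (z - c) / r) ^+ n.
  pose g w := f w * (w - c) ^- n.
  have : modulus (g z) <= M / r ^+ n.
    apply: (@max_modulus_disc R g c r _ r0 _ _ z (ltW zr)).
      move=> w wr; have [wd|wd] := ltP (modulus (w - c)) d.
        (* near c, g is zero whatever its denominator *)
        apply/derivable1_diffP.
        apply: (@near_eq_derivable _ C C (cst 0)); last exact: derivable_cst.
        apply/nbhsCP; exists (d - modulus (w - c)); first by rewrite subr_gt0.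
        move=> y yw; rewrite /g f0 ?mul0r//.
        have := modulusD (y - w) (w - c); rewrite addrA subrK; lra.
      pose h : C -> C := (fun y : C => y - c) ^+ n.
      have hE y : h y = (y - c) ^+ n by rewrite /h exprfctE.
      have -> : g = f * (fun y => (h y)^-1) by apply/funext => y; rewrite /g -hE.
      apply: differentiableM; first exact: df _ wr.
      apply: differentiableV.
        apply: differentiable_exp; exact: differentiable_subc.
      by rewrite hE expf_neq0// -modulus_eq0 gt_eqF//; lra.
    move=> w wr; rewrite /g modulusM modulusV modulusX wr ler_wpM2r//.
      by rewrite invr_ge0 exprn_ge0// ltW.
    by apply: bM; rewrite /disc/= wr.
  rewrite /g modulusM modulusV modulusX ler_pdivrMr ?exprn_gt0//.
  by move=> /le_trans; apply; rewrite expr_div_n mulrA mulrAC.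
apply/eqP; rewrite -modulus_eq0 eq_le modulus_ge0 andbT leNgt; apply/negP => fz.
have : 1 <= modulus (z - c) / r.
  apply: (@expr_bounded_le _ _ _ (M / modulus (f z))).
    by rewrite divr_ge0 ?(ltW r0) ?(ltW zc0).
  move=> n; rewrite expr1n; have := gb n.+1.
  rewrite -[X in X <= _]mul1r -ler_pdivlMr//.
  by move=> /le_trans; apply; rewrite mulrAC.
by rewrite ler_pdivlMr// mul1r; lra.
Qed.

Definition diff_quot (f : C -> C) (t z : C) : C := (f (z + t) - f z) / t.

Lemma diff_quot_le (f : C -> C) (c t : C) (r M : R) : 0 < r ->
  (forall z, modulus (z - c) <= r -> differentiable f z) ->
  (forall z, modulus (z - c) <= r -> modulus (f z) <= M) ->
  modulus t <= r -> modulus (diff_quot f t c) <= 2 * M / r.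
Proof.
move=> r0 df fM tr.
have cr : modulus (c - c) <= r by rewrite subrr modulus0 ltW.
have M0 : 0 <= M by apply: le_trans (fM _ cr); exact: modulus_ge0.
have [->|t0] := eqVneq t 0.
  by rewrite /diff_quot invr0 mulr0 modulus0 divr_ge0 ?mulr_ge0 ?(ltW r0).
have tc : modulus (c + t - c) <= r by rewrite addrAC subrr add0r.
have := @schwarz (fun z => f z - f c) c r (2 * M) r0 _ (subrr _) _ (c + t) tc.
rewrite addrAC subrr add0r /diff_quot modulusM modulusV ler_pdivrMr; last first.
  by rewrite modulus_gt0.
apply.
  move=> z zr; apply: differentiableB; [exact: df z zr|exact: differentiable_cst].
move=> z zr; apply: (le_trans (modulusB _ _)).
have := fM c cr; have := fM z; rewrite zr lexx => /(_ isT); lra.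
Qed.

(** The difference quotient for a fixed increment is itself a bounded
    differentiable function, so [diff_quot_le] applied twice bounds second
    differences. These measure the change of the quotient when the increment is
    halved; the changes form a geometric series whose sum bounds the distance
    to the derivative. *)
Lemma taylor2 (f : C -> C) (c t : C) (r M : R) : 0 < r ->
  (forall z, modulus (z - c) <= r -> differentiable f z) ->
  (forall z, modulus (z - c) <= r -> modulus (f z) <= M) ->
  modulus t <= r / 2 ->
  modulus (f (c + t) - f c - t * 'D_1 f c) <= 8 * M / r ^+ 2 * modulus t ^+ 2.
Proof.
move=> r0 df fM tr.
have r20 : 0 < r / 2 by lra.
have cr : modulus (c - c) <= r by rewrite subrr modulus0 ltW.
have M0 : 0 <= M by apply: le_trans (fM _ cr); exact: modulus_ge0.
have tri z w : modulus (z - c) <= modulus (z - w) + modulus (w - c).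
  by have := modulusD (z - w) (w - c); rewrite addrA subrK.
pose K := 8 * M / r ^+ 2.
have K0 : 0 <= K by rewrite mulr_ge0 ?mulr_ge0 ?invr_ge0 ?exprn_ge0// ltW.
have q2 s : modulus s <= r / 2 ->
    modulus (diff_quot f s (c + s) - diff_quot f s c) <= 2 * K * modulus s.
  move=> sr; have [->|s0] := eqVneq s 0.
    by rewrite /diff_quot invr0 !mulr0 subr0 modulus0 mulr0.
  have s0' : 0 < modulus s by rewrite modulus_gt0.
  have := @diff_quot_le (diff_quot f s) c s (r / 2) (2 * M / (r / 2)) r20 _ _ sr.
  rewrite {1}/diff_quot modulusM modulusV ler_pdivrMr//.
  rewrite (_ : 2 * (2 * M / (r / 2)) / (r / 2) = 2 * K); last first.
    by rewrite /K; field; rewrite gt_eqF.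
  apply.
    move=> z zr; rewrite (_ : (fun w => _) =
        ((fun w => f (s + 1 * w)) - f) * cst s^-1); last first.
      apply/funext => w; rewrite -[RHS]/((f (s + 1 * w) - f w) / s).
      by rewrite mul1r [s + w]addrC.
    apply: differentiableM; last exact: differentiable_cst.
    apply: differentiableB; last by apply: df; lra.
    apply: differentiable_scale; apply: df; rewrite mul1r.
    by have := tri (s + z) z; rewrite addrK; lra.
  move=> z zr; apply: diff_quot_le => // w wr.
    by apply: df; have := tri w z; lra.
  by apply: fM; have := tri w z; lra.
have step s : modulus s <= r / 2 ->
    modulus (diff_quot f s c - diff_quot f (s / 2) c) <= K * modulus s / 2.
  move=> sr.
  have s2 : modulus (s / 2) = modulus s / 2 by rewrite modulusM modulusV modulus_nat.
  have := q2 (s / 2); rewrite s2 => /(_ _) H.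
  rewrite (_ : diff_quot f s c - diff_quot f (s / 2) c =
    (diff_quot f (s / 2) (c + s / 2) - diff_quot f (s / 2) c) / 2).
    rewrite modulusM modulusV modulus_nat.
    have := H _; have := modulus_ge0 s; lra.
  rewrite /diff_quot; have -> : c + s / 2 + s / 2 = c + s by field.
  have [->|s0] := eqVneq s 0; first by rewrite !(mul0r, addr0, subrr).
  by field.
have tele n : modulus (diff_quot f t c - diff_quot f (t / 2 ^+ n) c)
    <= K * modulus t * (1 - 2 ^- n).
  elim: n => [|n IH]; first by rewrite expr0 divr1 subrr modulus0 invr1 subrr mulr0.
  have tn : modulus (t / 2 ^+ n) = modulus t * 2 ^- n.
    by rewrite modulusM modulusV modulusX modulus_nat.
  have p0 : 0 < 2 ^- n :> R by rewrite invr_gt0 exprn_gt0.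
  have p1 : 2 ^- n <= 1 :> R.
    by rewrite invf_le1 ?exprn_gt0// exprn_ege1// ler1n.
  have := step (t / 2 ^+ n); rewrite tn => /(_ _) H.
  have pS : 2 ^- n.+1 = 2 ^- n / 2 :> R by rewrite exprS invfM mulrC.
  have -> : t / 2 ^+ n.+1 = t / 2 ^+ n / 2 by rewrite exprS invfM [2^-1 * _]mulrC mulrA.
  have := modulusD (diff_quot f t c - diff_quot f (t / 2 ^+ n) c)
    (diff_quot f (t / 2 ^+ n) c - diff_quot f (t / 2 ^+ n / 2) c).
  rewrite addrA subrK => /le_trans; apply.
  have {}H : modulus (diff_quot f (t / 2 ^+ n) c - diff_quot f (t / 2 ^+ n / 2) c)
      <= K * (modulus t * 2 ^- n) / 2.
    by apply: H; have := modulus_ge0 t; nra.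
  by rewrite pS; lra.
have [->|t0] := eqVneq t 0.
  by rewrite addr0 subrr mul0r subr0 modulus0 expr0n mulr0.
have t0' : 0 < modulus t by rewrite modulus_gt0.
suff : modulus (diff_quot f t c - 'D_1 f c) <= K * modulus t.
  move=> H; have -> : f (c + t) - f c - t * 'D_1 f c = (diff_quot f t c - 'D_1 f c) * t.
    by rewrite /diff_quot; field.
  by rewrite modulusM expr2 mulrA ler_wpM2r// ltW.
apply/ler_addgt0Pr => e e0.
have [d d0 Hd] := differentiable_approx (df c cr) e0.
have [|n nd] := @exp2_lt R (d / modulus t); first by rewrite divr_gt0.
have tn : modulus (t / 2 ^+ n) = modulus t * 2 ^- n.
  by rewrite modulusM modulusV modulusX modulus_nat.
have p0 : 0 < 2 ^- n :> R by rewrite invr_gt0 exprn_gt0.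
have tn0 : 0 < modulus (t / 2 ^+ n) by rewrite tn mulr_gt0.
have := Hd (c + t / 2 ^+ n); rewrite addrAC subrr add0r tn => /(_ _) H.
have := tele n.
have := modulusD (diff_quot f t c - diff_quot f (t / 2 ^+ n) c)
  (diff_quot f (t / 2 ^+ n) c - 'D_1 f c).
rewrite addrA subrK.
have : modulus (diff_quot f (t / 2 ^+ n) c - 'D_1 f c) <= e.
  have -> : diff_quot f (t / 2 ^+ n) c - 'D_1 f c =
     (f (c + t / 2 ^+ n) - f c - 'D_1 f c * (t / 2 ^+ n)) / (t / 2 ^+ n).
    rewrite /diff_quot; set s := t / 2 ^+ n; field.
    by rewrite -modulus_eq0 gt_eqF.
  rewrite modulusM modulusV ler_pdivrMr// tn; apply: H.
  by rewrite mulrC -ltr_pdivlMr.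
have : 0 <= K * modulus t * 2 ^- n.
  exact: (mulr_ge0 (mulr_ge0 K0 (ltW t0')) (ltW p0)).
lra.
Qed.

End Schwarz.

(** * Functions of several variables *)

Section Several.
Variable R : realType.
Local Notation C := (Cplx R).
Variable V : normedModType C.

Definition rnorm (x : V) : R := complex.Re `|x|.

Lemma rnormE (x : V) : `|x| = (rnorm x)%:C%C.
Proof. by rewrite /rnorm RRe_real// ger0_real. Qed.

Lemma rnorm_ge0 x : 0 <= rnorm x.
Proof. by rewrite -ler0c -rnormE. Qed.

Lemma rnormZ (a : C) x : rnorm (a *: x) = modulus a * rnorm x.
Proof. by apply: (@complexI R); rewrite -rnormE normrZ normE rnormE rmorphM. Qed.

Lemma rnormD x y : rnorm (x + y) <= rnorm x + rnorm y.
Proof. by rewrite -lecR rmorphD/= -!rnormE; exact: ler_normD. Qed.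

Lemma rnorm0 : rnorm 0 = 0.
Proof. by rewrite -(scale0r (0 : V)) rnormZ modulus0 mul0r. Qed.

Lemma nbhsVP (z : V) (A : set V) :
  nbhs z A <-> exists2 e : R, 0 < e & forall w, rnorm (w - z) < e -> A w.
Proof.
split.
  move/nbhs_ballP => [e /= e0 eA].
  have eE : e = (complex.Re e)%:C%C by rewrite RRe_real// gtr0_real.
  exists (complex.Re e); first by rewrite -ltcR -eE.
  move=> w we; apply: eA; rewrite -ball_normE /ball_/= distrC rnormE eE.
  by rewrite ltcR.
move=> [e e0 eA]; apply/nbhs_ballP; exists e%:C%C => /=; first by rewrite ltcR.
by move=> w; rewrite -ball_normE /ball_/= distrC rnormE ltcR; exact: eA.
Qed.

Lemma differentiable_line (f : V -> C) (c v : V) (t : C) :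
  differentiable f (c + t *: v) -> differentiable (fun s : C => f (c + s *: v)) t.
Proof.
move=> df.
have dg : differentiable (fun s : C => c + s *: v) t.
  have -> : (fun s : C => c + s *: v) = cst c + ( *:%R ^~ v : C -> V) by [].
  by apply: differentiableD; [exact: differentiable_cst|exact: ex_diff].
exact: (differentiable_comp dg df).
Qed.

Lemma derive_line (f : V -> C) (c v : V) :
  'D_1 (fun s : C => f (c + s *: v)) 0 = 'D_v f c.
Proof.
rewrite /derive.
have -> // : (fun h : C => h^-1 *: (((fun s : C => f (c + s *: v)) \o shift 0) (h *: 1)
    - f (c + 0 *: v))) = (fun h : C => h^-1 *: ((f \o shift c) (h *: v) - f c)).
by apply/funext => h /=; rewrite scale0r !addr0 [h%:A]mulr1 [_ + c]addrC.
Qed.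

Lemma taylor2_dir (f : V -> C) (c h : V) (r M : R) : 0 < r ->
  (forall z, rnorm (z - c) <= r -> differentiable f z) ->
  (forall z, rnorm (z - c) <= r -> modulus (f z) <= M) ->
  rnorm h <= r / 2 ->
  modulus (f (c + h) - f c - 'D_h f c) <= 8 * M / r ^+ 2 * rnorm h ^+ 2.
Proof.
move=> r0 df fM hr.
have M0 : 0 <= M.
  by apply: le_trans (modulus_ge0 (f c)) (fM _ _); rewrite subrr rnorm0 ltW.
have [h0|h0] := eqVneq (rnorm h) 0.
  have -> : h = 0 by apply/eqP; rewrite -normr_eq0 rnormE h0.
  by rewrite derive0 addr0 subrr subr0 modulus0 rnorm0 expr0n mulr0.
have hp : 0 < rnorm h by rewrite lt_neqAle eq_sym h0 rnorm_ge0.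
have inr z : modulus (z - 0) <= r / rnorm h -> rnorm (c + z *: h - c) <= r.
  by rewrite subr0 addrAC subrr add0r rnormZ ler_pdivlMr.
have := @taylor2 R (fun s => f (c + s *: h)) 0 1 (r / rnorm h) M.
rewrite derive_line add0r scale1r scale0r addr0 mul1r modulus1 expr1n mulr1.
rewrite expr_div_n invf_div mulrA => H; rewrite mulrAC; apply: H.
- by rewrite divr_gt0.
- by move=> z /inr zr; exact: (@differentiable_line f c h z (df _ zr)).
- by move=> z /inr zr; exact: fM.
- by rewrite ler_pdivlMr// ler_pdivlMr//; lra.
Qed.

Lemma differentiable_quadratic (E : V -> C) (z0 : V) (K r : R) : 0 < r ->
  (forall h, rnorm h < r -> modulus (E (z0 + h)) <= K * rnorm h ^+ 2) ->
  differentiable E z0.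
Proof.
move=> r0 EK.
have E0 : E z0 = 0.
  apply/eqP; rewrite -modulus_eq0 eq_le modulus_ge0 andbT.
  by have := EK 0; rewrite rnorm0 addr0 expr0n mulr0; exact.
have oE : E \o shift z0 = cst (E z0) + (0 : V -> C) +o_ 0 id.
  apply/eqaddoP => e e0.
  have eE : e = (complex.Re e)%:C%C by rewrite RRe_real// gtr0_real.
  have e0' : 0 < complex.Re e by rewrite -ltcR -eE.
  apply/nbhsVP; exists (Num.min r (complex.Re e / (`|K| + 1))).
    by rewrite lt_min r0 divr_gt0// ltr_wpDl.
  move=> h; rewrite subr0 lt_min => /andP[hr]; rewrite ltr_pdivlMr ?ltr_wpDl// => hK.
  rewrite E0 -[X in `|X| <= _]/(E (h + z0) - (0 + 0)) addr0 subr0.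
  rewrite normE rnormE eE -rmorphM lecR addrC.
  apply: (le_trans (EK h hr)).
  have := rnorm_ge0 h; have := ler_norm K; nra.
have d0 : 'd E z0 = 0 :> (V -> C).
  by apply: diff_unique; [exact: cst_continuous|exact: oE].
by apply/diff_locallyP; rewrite d0; split; [exact: cst_continuous|exact: oE].
Qed.

End Several.

Section Partial.
Variable R : realType.
Local Notation C := (Cplx R).

(** The identity theorem along the complex lines through a; the factor 4
    leaves room, on each line, for a disc around a that contains z. *)
Lemma identity_ball (V : normedModType C) (f : V -> C) (c a : V) (r : R) :
  (forall z, rnorm (z - c) < r -> differentiable f z) ->
  rnorm (a - c) < r / 4 -> (\forall z \near a, f z = 0) ->
  forall z, rnorm (z - c) < r / 4 -> f z = 0.
Proof.
move=> df ac fa z zc; pose v := z - a.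
have vr : rnorm v < r / 2.
  have -> : v = (z - c) - (a - c) by rewrite opprB addrA subrK.
  have := rnormD (z - c) (- (a - c)).
  have -> : rnorm (- (a - c)) = rnorm (a - c) by rewrite /rnorm normrN.
  lra.
have r0 : 0 < r by have := rnorm_ge0 (a - c); lra.
(* the points a + t v with |t| <= 4 / 3, z among them for t = 1, lie in the ball *)
have inr (t : C) : modulus (t - 0) <= 4 / 3 -> rnorm (a + t *: v - c) < r.
  rewrite subr0 => t43; rewrite addrAC.
  have := rnormD (a - c) (t *: v); rewrite rnormZ.
  have := modulus_ge0 t; have := rnorm_ge0 v; nra.
have /nbhsVP[d d0 Hd] := fa.
have := @identity_disc R (fun t => f (a + t *: v)) 0 (4 / 3) (d / (rnorm v + 1)).
have nv := rnorm_ge0 v.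
move=> /(_ _ _ _ 1) H; rewrite (_ : z = a + 1 *: v); last first.
  by rewrite scale1r addrC subrK.
apply: H.
- by rewrite divr_gt0//; lra.
- move=> t /inr tr; exact: (differentiable_line (df _ tr)).
- move=> t; rewrite subr0 ltr_pdivlMr => [td|]; last by lra.
  apply: Hd; rewrite addrAC subrr add0r rnormZ.
  have := modulus_ge0 t; nra.
- by rewrite subr0 modulus1; lra.
Qed.

(** All bounded functions have limits along one and the same ultrafilter; this
    provides the second derivatives in [derive_differentiable]. *)
Lemma ultra_bounded_cvg (T : Type) (G : set_system T) (u : T -> C) (K : R) :
  UltraFilter G -> G [set t | modulus (u t) <= K] ->
  exists l : C, u @ G --> l.
Proof.
move=> UG uK.
have UI : UltraFilter (u @ G).
  split.
    exact: fmap_proper_filter.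
  move=> H PH sub; apply/seteqP; split => // A HA.
  have [|GA] := in_ultra_setVsetC (u @^-1` A) UG; first by [].
  exfalso; have /sub HnA : (u @ G) (~` A) by [].
  by have /filter_ex[x []] : H (A `&` ~` A) by exact: filterI.
have := @compact_disc R 0 K; rewrite compact_ultra => /(_ _ UI).
case; last by move=> l [_ Hl]; exists l.
apply: (@filterS _ G _ _ _ _ uK) => t /= tK; rewrite /disc /= subr0.
exact: tK.
Qed.

Lemma sum_cvg (T : Type) (F : set_system T) (FF : Filter F) (J : Type)
    (s : seq J) (u : J -> T -> C) (l : J -> C) :
  (forall i, u i @ F --> l i) ->
  (fun t => \sum_(i <- s) u i t) @ F --> \sum_(i <- s) l i.
Proof.
move=> ul; elim: s => [|i s IH].
  rewrite big_nil (_ : (fun t => _) = cst 0); first exact: cvg_cst.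
  by apply/funext => t; rewrite big_nil.
rewrite big_cons (_ : (fun t => _) = u i + (fun t => \sum_(i <- s) u i t)).
  exact: cvgD (ul i) IH.
by apply/funext => t; rewrite big_cons.
Qed.

(** The difference quotients q t z = (f (z + t v) - f z) / t are bounded uniformly
    in t, and hence so are the remainders of their first order expansions at z0
    ([taylor2_dir]). In the limit t -> 0 this is a first order expansion of
    'D_v f, whose linear part L is a limit of the differentials of q t. *)
Lemma derive_differentiable n (f : 'rV[C]_n -> C) (z0 v : 'rV[C]_n) :
  (\forall z \near z0, differentiable f z) ->
  differentiable (fun z => 'D_v f z) z0.
Proof.
move=> df.
have fc : {for z0, continuous f}.
  by apply: differentiable_continuous; exact: nbhs_singleton df.
pose M := modulus (f z0) + 1.
have /nbhsVP[r0 r00 Hr] : \forall z \near z0, differentiable f z /\ modulus (f z) <= M.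
  have F1 : nbhs z0 (f @^-1` [set w | modulus (w - f z0) < 1]).
    by apply: fc; apply/nbhsCP; exists 1.
  apply: filterS2 df F1 => z dz /= fz; split=> //.
  by have := modulusD (f z - f z0) (f z0); rewrite subrK /M; lra.
pose r := r0 / 4.
have r_gt0 : 0 < r by rewrite /r; lra.
have Hr3 z : rnorm (z - z0) <= 3 * r -> differentiable f z /\ modulus (f z) <= M.
  by move=> zr; apply: Hr; rewrite /r in zr; lra.
have M0 : 0 <= M by rewrite addr_ge0// modulus_ge0.
(* increments t v with |t| <= t1 have length at most r *)
pose t1 := r / (rnorm v + 1).
have v0 := rnorm_ge0 v.
have t10 : 0 < t1 by rewrite divr_gt0//; lra.
have t1v : t1 * rnorm v <= r.
  by rewrite /t1 mulrAC ler_pdivrMr; nra.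
have shiftr (t : C) z : modulus t <= t1 -> rnorm (z - z0) <= 2 * r ->
    rnorm (z + t *: v - z0) <= 3 * r.
  move=> tr zr; rewrite addrAC; have := rnormD (z - z0) (t *: v).
  rewrite rnormZ; have := modulus_ge0 t; nra.
pose q (t : C) z := (f (z + t *: v) - f z) / t.
pose M' := 2 * M / t1.
have M'0 : 0 <= M' by exact: (divr_ge0 (mulr_ge0 (ler0n _ 2) M0) (ltW t10)).
have qM (t : C) z : modulus t <= t1 -> rnorm (z - z0) <= 2 * r -> modulus (q t z) <= M'.
  move=> tr zr.
  have := @diff_quot_le R (fun s => f (z + s *: v)) 0 t t1 M t10.
  rewrite /diff_quot add0r scale0r addr0 => H; apply: (H _ _ tr).
    move=> s; rewrite subr0 => sr.
    exact: (differentiable_line (Hr3 _ (shiftr s z sr zr)).1).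
  by move=> s; rewrite subr0 => sr; have [] := Hr3 _ (shiftr s z sr zr).
have qd (t : C) z : modulus t <= t1 -> rnorm (z - z0) <= 2 * r -> differentiable (q t) z.
  move=> tr zr.
  have -> : q t = ((f \o (id + cst (t *: v))) - f) * cst t^-1 by [].
  apply: differentiableM; last exact: differentiable_cst.
  apply: differentiableB; last by apply: (Hr3 _ _).1; lra.
  apply: differentiable_comp; last exact: (Hr3 _ (shiftr _ _ tr zr)).1.
  by apply: differentiableD; [exact: ex_diff|exact: differentiable_cst].
pose K := 8 * M' / r ^+ 2.
have K0 : 0 <= K.
  exact: (divr_ge0 (mulr_ge0 (ler0n _ 8) M'0) (exprn_ge0 _ (ltW r_gt0))).
have T2 (t : C) h : modulus t <= t1 -> rnorm h <= r / 2 ->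
    modulus (q t (z0 + h) - q t z0 - 'D_h (q t) z0) <= K * rnorm h ^+ 2.
  move=> tr hr; apply: (taylor2_dir r_gt0 _ _ hr) => z zr.
    by apply: qd => //; lra.
  by apply: qM => //; lra.
have z00 : rnorm (z0 - z0) <= 2 * r by rewrite subrr rnorm0; lra.
(* the estimate T2 is uniform in t: it passes to the limit along an ultrafilter
   that refines the punctured neighbourhoods of 0 *)
have [G [UG sG]] := ultraFilterLemma (@Proper_dnbhs_numFieldType C 0).
have PG : ProperFilter G by exact: ultra_proper.
have Gt1 : G [set t | modulus t <= t1].
  apply: sG; apply/nbhsCP; exists t1 => // w; rewrite subr0 => /ltW wt _.
  exact: wt.
have lin (t : C) h : modulus t <= t1 ->
   'D_h (q t) z0 = \sum_i h 0 i * 'D_(delta_mx 0 i) (q t) z0.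
  move=> tr; have dq := qd t z0 tr z00; rewrite (deriveE _ dq).
  rewrite {1}(row_sum_delta h) linear_sum; apply: eq_bigr => i _.
  by rewrite linearZ /= (deriveE _ dq).
have ex i : exists l : C, (fun t => 'D_(delta_mx 0 i) (q t) z0) @ G --> l.
  set d : 'rV[C]_n := delta_mx 0 i.
  (* T2 bounds the derivative in the direction d scaled into the ball *)
  pose a := r / 2 / (rnorm d + 1).
  have d0 := rnorm_ge0 d.
  have a0 : 0 < a by apply: divr_gt0; lra.
  apply: (@ultra_bounded_cvg _ G _ ((2 * M' + K * (r / 2) ^+ 2) / a)) => //.
  apply: filterS Gt1 => t /= tr.
  have nh : rnorm (a%:C%C *: d) <= r / 2.
    by rewrite rnormZ modulus_real ?(ltW a0)// /a mulrAC ler_pdivrMr; nra.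
  have := T2 t _ tr nh.
  have -> : 'D_(a%:C%C *: d) (q t) z0 = a%:C%C * 'D_d (q t) z0.
    by have dq := qd t z0 tr z00; rewrite !(deriveE _ dq) linearZ.
  rewrite ler_pdivlMr// => H.
  have := qM t z0 tr z00.
  have : modulus (q t (z0 + a%:C%C *: d)) <= M'.
    by apply: qM => //; rewrite addrAC subrr add0r; lra.
  set A := q t (z0 + _) in H *; set B := q t z0 in H *.
  set D := 'D_d _ _ in H *.
  have -> : modulus D * a = modulus (a%:C%C * D).
    by rewrite modulusM modulus_real ?(ltW a0)// mulrC.
  have := modulusB (A - B) (A - B - a%:C%C * D); rewrite opprB addrC subrK.
  have := modulusB A B.
  have : K * rnorm (a%:C%C *: d) ^+ 2 <= K * (r / 2) ^+ 2.
    by rewrite ler_wpM2l// lerXn2r ?nnegrE ?rnorm_ge0// ltW//; lra.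
  lra.
have [l lP] := choice ex.
pose L (h : 'rV[C]_n) : C := \sum_i h 0 i * l i.
have qv z : rnorm (z - z0) <= 2 * r -> (fun t => q t z) @ G --> 'D_v f z.
  move=> zr; apply: (cvg_trans _ _); first exact: (cvg_fmap2 sG).
  have dfz : derivable f z v by apply: diff_derivable; apply: (Hr3 _ _).1; lra.
  apply: cvg_trans dfz; apply: near_eq_cvg; near=> t.
  by rewrite /q /= mulrC [_ + z]addrC.
pose E z := 'D_v f z - 'D_v f z0 - L (z - z0).
have dE : differentiable E z0.
  apply: (@differentiable_quadratic _ _ E z0 K (r / 2)); first by lra.
  move=> h hr; have hE : z0 + h - z0 = h by rewrite addrAC subrr add0r.
  rewrite /E hE.
  have cv : (fun t => q t (z0 + h) - q t z0 - 'D_h (q t) z0) @ G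
     --> 'D_v f (z0 + h) - 'D_v f z0 - L h.
    apply: cvgB.
      by apply: cvgB; apply: qv; rewrite ?hE//; lra.
    have -> : L h = \sum_i h 0 i * l i by [].
    apply: (@cvg_trans _ ((fun t => \sum_i h 0 i * 'D_(delta_mx 0 i) (q t) z0) @ G)).
      apply: near_eq_cvg; apply: filterS Gt1 => t tr.
      by rewrite (lin t h tr).
    apply: (@sum_cvg _ G _ _ _ (fun i t => h 0 i * 'D_(delta_mx 0 i) (q t) z0)) => i.
    by apply: cvgM; [exact: cvg_cst|exact: lP].
  have cl : closed [set w : C | modulus w <= K * rnorm h ^+ 2].
    have := @closed_disc R 0 (K * rnorm h ^+ 2).
    by rewrite (_ : disc _ _ = [set w : C | modulus w <= K * rnorm h ^+ 2])//;
      apply/seteqP; split=> w; rewrite /disc /= subr0.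
  apply: (closed_cvg _ cl _ _ cv).
  by apply: filterS Gt1 => t tr; apply: T2 => //; lra.
have -> : (fun z => 'D_v f z) = E + (cst ('D_v f z0) +
    \sum_i ((fun z : 'rV[C]_n => (z - z0) 0 i) * cst (l i))).
  apply/funext => z.
  pose S := \sum_i ((fun y : 'rV[C]_n => (y - z0) 0 i) * cst (l i)).
  have SL : S z = L (z - z0) by rewrite /S fct_sumE.
  rewrite -[RHS]/(E z + ('D_v f z0 + S z)) SL /E; move: (L _) ('D_v f z) ('D_v f z0) => a b b0.
  by rewrite [b0 + a]addrC addrA subrK subrK.
apply: differentiableD; first exact: dE.
apply: differentiableD; first exact: differentiable_cst.
apply: differentiable_sum => i.
apply: differentiableM; last exact: differentiable_cst.
have dsub : differentiable (fun z : 'rV[C]_n => z - z0) z0.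
  have -> : (fun z : 'rV[C]_n => z - z0) = id - cst z0 by [].
  by apply: differentiableB; [exact: ex_diff|exact: differentiable_cst].
exact: (differentiable_comp dsub (differentiable_coord _ _ _)).
Unshelve. all: by end_near. Qed.

End Partial.

(** * Jacobian matrices *)

Section NearEq.
Variables (K : numFieldType) (V W : normedModType K).

Lemma near_eq_diff (f g : V -> W) (z : V) :
  (\forall w \near z, f w = g w) -> differentiable f z ->
  differentiable g z /\ 'd g z = 'd f z :> (V -> W).
Proof.
move=> fg df.
have fgz : f z = g z by exact: nbhs_singleton fg.
have og : g \o shift z = cst (g z) + 'd f z +o_ 0 id.
  apply/eqaddoP => e e0.
  have /diff_locally/eqaddoP/(_ e e0) := df.
  move: fg; rewrite (near_shift 0 z) => fg; apply: filterS2 fg => h /=.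
  rewrite /= subr0 => fgh.
  rewrite -[X in `|X| <= _]/(f (h + z) - (f z + 'd f z h)).
  by rewrite -[X in _ -> `|X| <= _]/(g (h + z) - (g z + 'd f z h)) fgz fgh.
have dg : 'd g z = 'd f z :> (V -> W).
  by apply: diff_unique; [exact: diff_continuous df|exact: og].
split=> //; apply/diff_locallyP; rewrite dg.
by split; [exact: diff_continuous df|exact: og].
Qed.

End NearEq.

Section Jacobian.
Variable R : realType.
Local Notation C := (Cplx R).

Lemma differentiable_mx (V : normedModType C) m k (M : V -> 'M[C]_(m, k)) (z : V) :
  (forall i j, differentiable (fun w => M w i j : C) z) -> differentiable M z.
Proof.
move=> dM.
have -> : M = \sum_i \sum_j (fun w => M w i j *: delta_mx i j).
  apply/funext => w; rewrite fct_sumE {1}[M w]matrix_sum_delta; apply: eq_bigr => i _.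
  by rewrite fct_sumE.
apply: differentiable_sum => i; apply: differentiable_sum => j.
exact: (differentiableZl (delta_mx i j) (dM i j)).
Qed.

Lemma differentiable_entry (V : normedModType C) m k
    (M : V -> 'M[C]_(m, k)) (z : V) i j :
  differentiable M z -> differentiable (fun w => M w i j : C) z.
Proof.
by move=> dM; exact: (differentiable_comp dM (differentiable_coord _ i j)).
Qed.

Lemma differentiable_mulmx (V : normedModType C) m k p
    (A : V -> 'M[C]_(m, k)) (B : V -> 'M[C]_(k, p)) (z : V) :
  differentiable A z -> differentiable B z ->
  differentiable (fun w => A w *m B w) z.
Proof.
move=> dA dB; apply: differentiable_mx => i j.
have -> : (fun w => (A w *m B w) i j) =
    \sum_l ((fun w => A w i l) * (fun w => B w l j)).
  by apply/funext => w; rewrite fct_sumE mxE.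
apply: differentiable_sum => l.
by apply: differentiableM; apply: differentiable_entry.
Qed.

Lemma differentiable_trmx (V : normedModType C) m k (A : V -> 'M[C]_(m, k)) (z : V) :
  differentiable A z -> differentiable (fun w => (A w)^T) z.
Proof.
move=> dA; apply: differentiable_mx => i j.
have -> : (fun w => (A w)^T i j) = (fun w => A w j i) by apply/funext => w; rewrite mxE.
exact: differentiable_entry.
Qed.

Lemma mul_jacobian n m (f : 'rV[C]_n -> 'rV[C]_m) (z u : 'rV[C]_n) :
  u *m jacobian f z = 'd f z u.
Proof. exact: mul_rV_lin1. Qed.

Lemma jacobianP n m (f : 'rV[C]_n -> 'rV[C]_m) (z : 'rV[C]_n) (A : 'M[C]_(n, m)) :
  (forall u, 'd f z u = u *m A) -> jacobian f z = A.
Proof. by move=> H; apply/row_matrixP => i; rewrite !rowE mul_jacobian H. Qed.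

Lemma jacobian_comp n m p (f : 'rV[C]_n -> 'rV[C]_m) (g : 'rV[C]_m -> 'rV[C]_p) z :
  differentiable f z -> differentiable g (f z) ->
  jacobian (g \o f) z = jacobian f z *m jacobian g (f z).
Proof.
move=> df dg; apply: jacobianP => u.
by rewrite (diff_comp df dg) mulmxA !mul_jacobian.
Qed.

Lemma jacobian_near n m (f g : 'rV[C]_n -> 'rV[C]_m) z :
  (\forall w \near z, f w = g w) -> differentiable f z ->
  jacobian g z = jacobian f z.
Proof.
move=> fg df; have [_ dg] := near_eq_diff fg df.
by apply: jacobianP => u; rewrite dg mul_jacobian.
Qed.

Lemma jacobian_id n (z : 'rV[C]_n) : jacobian id z = 1%:M.
Proof. by apply: jacobianP => u; rewrite diff_val mulmx1. Qed.

Lemma diff_coord m n (M u : 'M[C]_(m, n)) i j :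
  'd (fun N : 'M[C]_(m, n) => N i j : C) M u = u i j.
Proof.
have cl : linear (fun N : 'M[C]_(m, n) => N i j : C) by move=> a A B; rewrite !mxE.
pose cM := GRing.isLinear.Build _ _ _ _ _ cl.
pose cL : {linear 'M[C]_(m, n) -> C} := HB.pack (fun N : 'M[C]_(m, n) => N i j : C) cM.
have := @diff_lin _ _ _ cL M (@matrix_normedtype.coord_continuous C m n i j).
by rewrite (_ : (cL : _ -> _) = (fun N : 'M[C]_(m, n) => N i j : C))// => ->.
Qed.

Lemma diff_entry (V : normedModType C) m k (f : V -> 'M[C]_(m, k)) (z u : V) i j :
  differentiable f z -> 'd f z u i j = 'd (fun w => f w i j : C) z u.
Proof.
move=> df.
have -> : (fun w => f w i j : C) = (fun N : 'M[C]_(m, k) => N i j : C) \o f by [].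
by rewrite (diff_comp df (differentiable_coord _ i j)) /= diff_coord.
Qed.

Lemma differentiable_jacobian n m (f : 'rV[C]_n -> 'rV[C]_m) z :
  (\forall w \near z, differentiable f w) -> differentiable (jacobian f) z.
Proof.
move=> df; apply: differentiable_mx => i j.
have dj : differentiable (fun w => 'D_(delta_mx 0 i) (fun y => f y 0 j : C) w) z.
  apply: derive_differentiable.
  by apply: filterS df => w dw; exact: differentiable_entry.
apply: (near_eq_diff _ dj).1.
apply: filterS df => w dw.
rewrite deriveE; last exact: differentiable_entry.
by rewrite -(diff_entry _ _ _ dw) -mul_jacobian -rowE mxE.
Qed.

Section Block.
Variables (n m p q : nat) (f : 'rV[C]_n -> 'rV[C]_p) (g : 'rV[C]_m -> 'rV[C]_q).
Variable z : 'rV[C]_(n + m).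
Hypotheses (df : differentiable f (lsubmx z)) (dg : differentiable g (rsubmx z)).

Let F (y : 'rV[C]_(n + m)) := row_mx (f (lsubmx y)) (g (rsubmx y)).

Lemma jacobian_row_mx :
  jacobian F z = block_mx (jacobian f (lsubmx z)) 0 0 (jacobian g (rsubmx z)).
Proof.
have dfl : differentiable (f \o lsubmx) z.
  by apply: differentiable_comp; [exact: differentiable_lsubmx|exact: df].
have dgr : differentiable (g \o rsubmx) z.
  by apply: differentiable_comp; [exact: differentiable_rsubmx|exact: dg].
have dF : differentiable F z := differentiable_row_mx dfl dgr.
apply: jacobianP => u; rewrite -[X in _ = X *m _](hsubmxK u).
rewrite mul_row_block !mulmx0 addr0 add0r !mul_jacobian.
have el : 'd (f \o lsubmx) z u = 'd f (lsubmx z) (lsubmx u).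
  rewrite (diff_comp (differentiable_lsubmx _) df) /=.
  by rewrite (@diff_lin _ _ _ lsubmx z (@continuous_lsubmx _ _ _ _)).
have er : 'd (g \o rsubmx) z u = 'd g (rsubmx z) (rsubmx u).
  rewrite (diff_comp (differentiable_rsubmx _) dg) /=.
  by rewrite (@diff_lin _ _ _ rsubmx z (@continuous_rsubmx _ _ _ _)).
apply/rowP => j; rewrite (diff_entry _ _ _ dF).
case: (split_ordP j) => j' ->.
  rewrite row_mxEl -el (diff_entry _ _ _ dfl).
  suff -> : (fun w => F w 0 (lshift q j')) = (fun w => (f \o lsubmx) w 0 j') by [].
  by apply/funext => w; rewrite /F row_mxEl.
rewrite row_mxEr -er (diff_entry _ _ _ dgr).
suff -> : (fun w => F w 0 (rshift p j')) = (fun w => (g \o rsubmx) w 0 j') by [].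
by apply/funext => w; rewrite /F row_mxEr.
Qed.

End Block.

Lemma differentiable_block (V : normedModType C) n m p q (A : V -> 'M[C]_(n, m))
    (B : V -> 'M[C]_(p, q)) z :
  differentiable A z -> differentiable B z ->
  differentiable (fun w => block_mx (A w) 0 0 (B w)) z.
Proof.
move=> dA dB; apply: differentiable_mx => i j.
case: (split_ordP i) => i' ->; case: (split_ordP j) => j' ->.
- rewrite (_ : (fun w => _) = (fun w => A w i' j')); first exact: differentiable_entry dA.
  by apply/funext => w; rewrite block_mxEul.
- rewrite (_ : (fun w => _) = cst 0); first exact: differentiable_cst.
  by apply/funext => w; rewrite block_mxEur mxE.
- rewrite (_ : (fun w => _) = cst 0); first exact: differentiable_cst.
  by apply/funext => w; rewrite block_mxEdl mxE.
- rewrite (_ : (fun w => _) = (fun w => B w i' j')); first exact: differentiable_entry dB.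
  by apply/funext => w; rewrite block_mxEdr.
Qed.

End Jacobian.

(** * Maps in charts *)

Section Charts.
Variable R : realType.
Local Notation C := (Cplx R).

Lemma continuous_id_for (T : topologicalType) (x : T) : {for x, continuous id}.
Proof. by move=> A. Qed.

(** The expression of f in coordinates; [in_charts id phi psi] is the transition from
    phi to psi. *)
Definition in_charts (T U : topologicalType) n m (f : T -> U)
  (phi : chart R T n) (psi : chart R U m) : 'rV[C]_n -> 'rV[C]_m :=
  coord psi \o f \o point phi.

Lemma near_point (T : topologicalType) n (phi : chart R T n) x (P : T -> Prop) :
  dom phi x -> (\forall y \near x, P y) ->
  \forall z \near coord phi x, P (point phi z).
Proof.
move=> phix nP; apply: (point_continuous (coord_cod phix)).
by rewrite coordK.
Qed.

Lemma near_coord (T : topologicalType) n (phi : chart R T n) x (P : 'rV[C]_n -> Prop) :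
  dom phi x -> (\forall z \near coord phi x, P z) ->
  \forall y \near x, P (coord phi y).
Proof. by move=> phix nP; exact: (coord_continuous phix). Qed.

Lemma dom_near (T : topologicalType) n (phi : chart R T n) x :
  dom phi x -> \forall y \near x, dom phi y.
Proof. by move=> phix; apply: open_nbhs_nbhs; split=> //; exact: dom_open. Qed.

Lemma cod_near (T : topologicalType) n (phi : chart R T n) z :
  cod phi z -> \forall w \near z, cod phi w.
Proof. by move=> phiz; apply: open_nbhs_nbhs; split=> //; exact: cod_open. Qed.

Section Comp.
Variables (T U S : topologicalType) (n m p : nat).
Variables (f : T -> U) (g : U -> S) (phi : chart R T n) (psi : chart R U m)
  (chi : chart R S p) (x : T).
Hypotheses (phix : dom phi x) (fx : {for x, continuous f}) (psifx : dom psi (f x)).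

Lemma in_charts_comp_near :
  \forall z \near coord phi x,
    (in_charts g psi chi \o in_charts f phi psi) z = in_charts (g \o f) phi chi z.
Proof.
have nf : \forall y \near x, dom psi (f y) by apply: fx; exact: dom_near.
apply: filterS (near_point phix nf) => z dz.
by rewrite /in_charts /= coordK.
Qed.

Hypotheses (df : differentiable (in_charts f phi psi) (coord phi x))
  (dg : differentiable (in_charts g psi chi) (coord psi (f x))).

Let in_charts_image : in_charts f phi psi (coord phi x) = coord psi (f x).
Proof. by rewrite /in_charts /= coordK. Qed.

Lemma differentiable_in_charts_comp :
  differentiable (in_charts (g \o f) phi chi) (coord phi x).
Proof.
apply: (near_eq_diff in_charts_comp_near _).1.
by apply: differentiable_comp; [exact: df|rewrite in_charts_image; exact: dg].
Qed.

Lemma jacobian_in_charts_comp :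
  jacobian (in_charts (g \o f) phi chi) (coord phi x) =
  jacobian (in_charts f phi psi) (coord phi x) *m
  jacobian (in_charts g psi chi) (coord psi (f x)).
Proof.
have dg' : differentiable (in_charts g psi chi) (in_charts f phi psi (coord phi x)).
  by rewrite in_charts_image; exact: dg.
rewrite (jacobian_near in_charts_comp_near); last exact: (differentiable_comp df dg').
by rewrite (jacobian_comp df dg') in_charts_image.
Qed.

End Comp.

Lemma jacobian_in_charts_id (T : topologicalType) n (f : T -> T) (phi : chart R T n) x :
  dom phi x -> (\forall y \near x, f y = y) ->
  jacobian (in_charts f phi phi) (coord phi x) = 1%:M.
Proof.
move=> phix fid; rewrite -(jacobian_id (coord phi x)).
apply: jacobian_near; last exact: ex_diff.
apply: filterS2 (cod_near (coord_cod phix)) (near_point phix fid) => z cz fz.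
by rewrite /in_charts /= fz pointK.
Qed.

Section Manifold.
Variables (n : nat) (X : complexManifold R n).

Lemma overlap_coord (phi psi : chart R X n) x :
  dom phi x -> dom psi x -> overlap phi psi (coord phi x).
Proof. by move=> phix psix; split; [exact: coord_cod|rewrite coordK]. Qed.

Lemma atlas_holomorphic_chart (phi : chart R X n) :
  atlas phi -> holomorphic_chart phi.
Proof. by move=> aphi psi apsi; split; exact: atlas_holomorphic. Qed.

(** Charts of the maximal atlas are compatible with one another through any chart
    of the atlas. *)
Lemma differentiable_transition (phi psi : chart R X n) x :
  holomorphic_chart phi -> holomorphic_chart psi -> dom phi x -> dom psi x ->
  differentiable (in_charts id phi psi) (coord phi x).
Proof.
move=> hphi hpsi phix psix.
have [chi achi chix] := atlas_cover x.
apply: (@differentiable_in_charts_comp _ _ _ _ _ _ id id phi chi psi x phix).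
- exact: continuous_id_for.
- exact: chix.
- exact: (hphi chi achi).1 (overlap_coord phix chix).
- exact: (hpsi chi achi).2 (overlap_coord chix psix).
Qed.

Lemma jacobian_transition (phi psi chi : chart R X n) x :
  holomorphic_chart phi -> holomorphic_chart psi -> holomorphic_chart chi ->
  dom phi x -> dom psi x -> dom chi x ->
  jacobian (in_charts id phi chi) (coord phi x) =
  jacobian (in_charts id phi psi) (coord phi x) *m
  jacobian (in_charts id psi chi) (coord psi x).
Proof.
move=> hphi hpsi hchi phix psix chix.
apply: (@jacobian_in_charts_comp _ _ _ _ _ _ id id phi psi chi x phix).
- exact: continuous_id_for.
- exact: psix.
- exact: differentiable_transition.
- exact: differentiable_transition.
Qed.

Lemma jacobian_transition_unit (phi psi : chart R X n) x :
  holomorphic_chart phi -> holomorphic_chart psi -> dom phi x -> dom psi x ->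
  jacobian (in_charts id phi psi) (coord phi x) \in unitmx.
Proof.
move=> hphi hpsi phix psix.
have := jacobian_transition hphi hpsi hphi phix psix phix.
rewrite (jacobian_in_charts_id phix); last exact: nearW.
by move=> e; have [h _] := mulmx1_unit (esym e); exact: h.
Qed.

Fact chart_choice : {c : X -> chart R X n | forall x, atlas (c x) /\ dom (c x) x}.
Proof.
apply: cid.
have [|c cP] := @choice _ _ (fun x (phi : chart R X n) => atlas phi /\ dom phi x).
  by move=> x; have [phi] := atlas_cover x; exists phi.
by exists c.
Qed.

Definition chart_at : X -> chart R X n := sval chart_choice.

Lemma chart_at_atlas x : atlas (chart_at x).
Proof. exact: (svalP chart_choice x).1. Qed.

Lemma chart_at_dom x : dom (chart_at x) x.
Proof. exact: (svalP chart_choice x).2. Qed.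

End Manifold.

Section Maps.
Variables (n m : nat) (X : complexManifold R n) (Y : complexManifold R m).
Variables (f : X -> Y) (x : X).
Hypothesis fx : holomorphic_at f x.

Lemma differentiable_in_charts (phi : chart R X n) (psi : chart R Y m) :
  holomorphic_chart phi -> holomorphic_chart psi -> dom phi x -> dom psi (f x) ->
  differentiable (in_charts f phi psi) (coord phi x).
Proof.
move=> hphi hpsi phix psix; have [cf df] := fx.
have aX := atlas_holomorphic_chart (chart_at_atlas x).
have aY := atlas_holomorphic_chart (chart_at_atlas (f x)).
have [dX dY] := (chart_at_dom x, chart_at_dom (f x)).
apply: (@differentiable_in_charts_comp _ _ _ _ _ _ id f phi (chart_at x) psi x phix).
- exact: continuous_id_for.
- exact: dX.
- exact: differentiable_transition.
apply: (@differentiable_in_charts_comp _ _ _ _ _ _ f id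
  (chart_at x) (chart_at (f x)) psi x dX).
- exact: cf.
- exact: dY.
- exact: df (chart_at_atlas _) (chart_at_atlas _) dX dY.
- exact: differentiable_transition.
Qed.

Lemma jacobian_in_charts_change (phi phi' : chart R X n) (psi psi' : chart R Y m) :
  holomorphic_chart phi -> holomorphic_chart phi' ->
  holomorphic_chart psi -> holomorphic_chart psi' ->
  dom phi x -> dom phi' x -> dom psi (f x) -> dom psi' (f x) ->
  jacobian (in_charts f phi psi) (coord phi x) =
  jacobian (in_charts id phi phi') (coord phi x) *m
  jacobian (in_charts f phi' psi') (coord phi' x) *m
  jacobian (in_charts id psi' psi) (coord psi' (f x)).
Proof.
move=> hphi hphi' hpsi hpsi' phix phix' psix psix'; have [cf _] := fx.
rewrite -mulmxA.
rewrite -(@jacobian_in_charts_comp _ _ _ _ _ _ f id phi' psi' psi x phix' cf psix').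
- apply: (@jacobian_in_charts_comp _ _ _ _ _ _ id f phi phi' psi x phix).
  + exact: continuous_id_for.
  + exact: phix'.
  + exact: differentiable_transition.
  + exact: differentiable_in_charts.
- exact: differentiable_in_charts.
- exact: differentiable_transition.
Qed.

End Maps.
End Charts.

(** * Holomorphic 1-forms and their pullbacks *)

Section Forms.
Variable R : realType.
Local Notation C := (Cplx R).

Section OneManifold.
Variables (n : nat) (X : complexManifold R n).

(** A list of k holomorphic 1-forms, as the columns of a matrix; this is
    [holomorphic_1form] when k = 1. *)
Definition holomorphic_forms k (w : chart R X n -> 'rV[C]_n -> 'M[C]_(n, k)) : Prop :=
  (forall phi, atlas phi -> forall z, cod phi z -> differentiable (w phi) z) /\
  (forall phi psi, atlas phi -> atlas psi ->
    forall z, overlap phi psi z ->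
    w phi z = jacobian (transition phi psi) z *m w psi (transition phi psi z)).

Lemma forms_change k (w : chart R X n -> 'rV[C]_n -> 'M[C]_(n, k))
    (phi psi : chart R X n) x :
  holomorphic_forms w -> atlas phi -> atlas psi -> dom phi x -> dom psi x ->
  w phi (coord phi x) =
  jacobian (in_charts id phi psi) (coord phi x) *m w psi (coord psi x).
Proof.
move=> [_ wT] aphi apsi phix psix.
rewrite (wT phi psi aphi apsi _ (overlap_coord phix psix)).
by rewrite [transition _ _ _]/transition /= coordK.
Qed.

Definition frame_at (w : chart R X n -> 'rV[C]_n -> 'M[C]_n) (x : X) : Prop :=
  exists phi, [/\ atlas phi, dom phi x & w phi (coord phi x) \in unitmx].

Lemma frame_atP (w : chart R X n -> 'rV[C]_n -> 'M[C]_n) phi x :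
  holomorphic_forms w -> frame_at w x -> atlas phi -> dom phi x ->
  w phi (coord phi x) \in unitmx.
Proof.
move=> hw [psi [apsi psix wu]] aphi phix.
rewrite (forms_change hw aphi apsi phix psix) unitmx_mul wu andbT.
by apply: jacobian_transition_unit => //; exact: atlas_holomorphic_chart.
Qed.

Definition generic_coframe (w : chart R X n -> 'rV[C]_n -> 'M[C]_n) : Prop :=
  holomorphic_forms w /\
  forall (x : X) (U : set X), nbhs x U -> exists2 y, U y & frame_at w y.

End OneManifold.

Section Pullback.
Variables (n m : nat) (X : complexManifold R n) (Y : complexManifold R m).
Variables (f : X -> Y) (k : nat) (w : chart R Y m -> 'rV[C]_m -> 'M[C]_(m, k)).

(** By [pullbackE] any other chart around f (point phi z) gives the same value. *)
Definition pullback (phi : chart R X n) (z : 'rV[C]_n) : 'M[C]_(n, k) :=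
  let y := f (point phi z) in
  jacobian (in_charts f phi (chart_at y)) z *m w (chart_at y) (coord (chart_at y) y).

Hypothesis hw : holomorphic_forms w.

Lemma pullbackE phi psi x : holomorphic_at f x ->
  holomorphic_chart phi -> atlas psi -> dom phi x -> dom psi (f x) ->
  pullback phi (coord phi x) =
  jacobian (in_charts f phi psi) (coord phi x) *m w psi (coord psi (f x)).
Proof.
move=> hf hphi apsi phix psix; have -> : pullback phi (coord phi x) =
    jacobian (in_charts f phi (chart_at (f x))) (coord phi x)
      *m w (chart_at (f x)) (coord (chart_at (f x)) (f x)).
  by rewrite /pullback (coordK phix).
have ha := chart_at_atlas (f x); have da := chart_at_dom (f x).
have hch := atlas_holomorphic_chart ha.
have hpsi := atlas_holomorphic_chart apsi.
have df := differentiable_in_charts hf hphi hpsi phix psix.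
have dt := differentiable_transition hpsi hch psix da.
have eJ := @jacobian_in_charts_comp _ _ _ _ _ _ _ f id phi psi (chart_at (f x)) x phix
  hf.1 psix df dt.
have eW := forms_change hw apsi ha psix da.
have e2 := congr1 (mulmx (jacobian (in_charts f phi psi) (coord phi x))) eW.
have e1 := congr1 (mulmx^~ (w (chart_at (f x)) (coord (chart_at (f x)) (f x)))) eJ.
exact: etrans e1 (etrans (esym (mulmxA _ _ _)) (esym e2)).
Qed.

(** Pulling back multiplies by the Jacobian matrix of f, whose entries are
    holomorphic by [derive_differentiable]. *)
Lemma holomorphic_pullback : holomorphic f -> holomorphic_forms pullback.
Proof.
move=> hf; split.
  move=> phi aphi z phiz; have dz := point_dom phiz.
  set x := point phi z in dz; have zE : z = coord phi x by rewrite /x pointK.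
  pose psi := chart_at (f x).
  have apsi : atlas psi := chart_at_atlas _.
  have dpsi : dom psi (f x) := chart_at_dom _.
  have hphi := atlas_holomorphic_chart aphi.
  have hpsi := atlas_holomorphic_chart apsi.
  have nf : \forall y \near x, dom phi y /\ dom psi (f y).
    apply: filterS2 (dom_near dz) _; last first.
      by apply: (hf x).1; exact: dom_near dpsi.
    by [].
  have nz : \forall w \near z, cod phi w /\ dom psi (f (point phi w)).
    rewrite zE; apply: filterS2 (cod_near (coord_cod dz)) (near_point dz nf).
    by move=> w' cw [].
  have nd : \forall w \near z, differentiable (in_charts f phi psi) w.
    apply: filterS nz => w' [cw dw]; rewrite -(pointK cw).
    by apply: differentiable_in_charts => //; exact: point_dom.
  have dJ : differentiable
      (fun y => jacobian (in_charts f phi psi) y *m w psi (in_charts f phi psi y)) z.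
    apply: differentiable_mulmx; first exact: differentiable_jacobian.
    apply: differentiable_comp; first exact: nbhs_singleton nd.
    by apply: hw.1 => //; rewrite zE /in_charts /= coordK//; exact: coord_cod.
  apply: (near_eq_diff _ dJ).1.
  apply: filterS nz => w' [cw dw].
  have e := pullbackE (hf _) hphi apsi (point_dom cw) dw.
  by rewrite (pointK cw) in e; exact: esym e.
move=> phi psi aphi apsi z [phiz psiz].
set x := point phi z in psiz; have dz : dom phi x := point_dom phiz.
have zE : z = coord phi x by rewrite /x pointK.
have TE : transition phi psi z = coord psi x by [].
have hphi := atlas_holomorphic_chart aphi.
have hpsi := atlas_holomorphic_chart apsi.
have ha := chart_at_atlas (f x); have da := chart_at_dom (f x).
rewrite TE zE (pullbackE (hf x) hphi ha dz da) (pullbackE (hf x) hpsi ha psiz da).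
have hch := atlas_holomorphic_chart ha.
have df := differentiable_in_charts (hf x) hpsi hch psiz da.
have dt := differentiable_transition hphi hpsi dz psiz.
have eJ := @jacobian_in_charts_comp _ _ _ _ _ _ _ id f phi psi (chart_at (f x)) x dz
  (@continuous_id_for _ x) psiz dt df.
have e1 := congr1 (mulmx^~ (w (chart_at (f x)) (coord (chart_at (f x)) (f x)))) eJ.
exact: etrans e1 (esym (mulmxA _ _ _)).
Qed.

End Pullback.

(** This covers isomorphisms, with A the whole of Y, and blow-ups, with A the
    complement of the centre. *)
Lemma pullback_generic_coframe n (X Y : complexManifold R n) (f : X -> Y) (g : Y -> X)
    (A : set Y) (w : chart R Y n -> 'rV[C]_n -> 'M[C]_n) :
  holomorphic f -> open A ->
  (forall y, A y -> holomorphic_at g y) ->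
  (forall y, A y -> f (g y) = y) ->
  (forall x, A (f x) -> g (f x) = x) ->
  (forall (x : X) (U : set X), nbhs x U -> exists2 y, U y & A (f y)) ->
  generic_coframe w -> generic_coframe (pullback f w).
Proof.
move=> hf oA hg fg gf dA [hw dw]; split; first exact: holomorphic_pullback.
move=> x U; rewrite nbhsE => -[U' [oU' U'x] U'U].
have [y0 U'y0 Ay0] := dA x U' (open_nbhs_nbhs (conj oU' U'x)).
have nA : nbhs (f y0) A by exact: open_nbhs_nbhs.
have nU : nbhs (f y0) (g @^-1` U').
  apply: (hg _ Ay0).1; rewrite gf//; exact: open_nbhs_nbhs.
have [y [Ay U'y] [psi [apsi psiy wu]]] := dw (f y0) _ (filterI nA nU).
exists (g y); first exact: U'U.
have fgy := fg _ Ay.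
exists (chart_at (g y)); split; [exact: chart_at_atlas|exact: chart_at_dom|].
have ha := chart_at_atlas (g y); have da := chart_at_dom (g y).
have hph := atlas_holomorphic_chart ha.
have hps := atlas_holomorphic_chart apsi.
have psify : dom psi (f (g y)) by rewrite fgy.
rewrite (pullbackE hw (hf (g y)) hph apsi da psify) unitmx_mul fgy wu andbT.
pose phi := chart_at (g y).
have dg : differentiable (in_charts g psi phi) (coord psi (f (g y))).
  rewrite fgy; apply: differentiable_in_charts => //; exact: hg.
have df : differentiable (in_charts f phi psi) (coord phi (g y)).
  by apply: differentiable_in_charts => //; exact: hf.
have := @jacobian_in_charts_comp _ _ _ _ _ _ _ f g phi psi phi (g y) da (hf _).1 psify df dg.
rewrite (jacobian_in_charts_id da) => [e|].
  by have [h _] := mulmx1_unit (esym e); exact: h.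
have nA' : nbhs (f (g y)) A by rewrite fgy; exact: open_nbhs_nbhs.
have nx : nbhs (g y) (f @^-1` A) := (hf (g y)).1 _ nA'.
by apply: filterS nx => x' Ax'; exact: gf.
Qed.

End Forms.

(** * Blow-ups *)

Section Blowup.
Variable R : realType.
Local Notation C := (Cplx R).

Let x0 (w : 'rV[C]_2) : C := w 0 0.

Let x1 (w : 'rV[C]_2) : C := w 0 1.

Let dx0 w : differentiable x0 w. Proof. exact: differentiable_coord. Qed.

Let dx1 w : differentiable x1 w. Proof. exact: differentiable_coord. Qed.

Let dx01 (w u : 'rV[C]_2) : 'd (x0 * x1) w u = w 0 0 * u 0 1 + w 0 1 * u 0 0.
Proof.
rewrite (diffM (dx0 w) (dx1 w)).
rewrite -[LHS]/(x0 w * 'd x1 w u + x1 w * 'd x0 w u).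
exact: (f_equal2 (fun a b => w 0 0 * a + w 0 1 * b) (diff_coord w u 0 1)
  (diff_coord w u 0 0)).
Qed.

Lemma ord2_cases (j : 'I_2) : j = 0 \/ j = 1.
Proof. by case: j => [[|[|]]] //= i; [left|right]; apply: val_inj. Qed.

Lemma sigma0_00 w : @sigma0 R w 0 0 = w 0 0. Proof. by rewrite mxE. Qed.

Lemma sigma0_01 w : @sigma0 R w 0 1 = w 0 0 * w 0 1. Proof. by rewrite mxE. Qed.

Lemma sigma1_00 w : @sigma1 R w 0 0 = w 0 0 * w 0 1. Proof. by rewrite mxE. Qed.

Lemma sigma1_01 w : @sigma1 R w 0 1 = w 0 1. Proof. by rewrite mxE. Qed.

Lemma differentiable_sigma0 w : differentiable (@sigma0 R) w.
Proof.
apply: differentiable_mx => i j; rewrite (ord1 i); case: (ord2_cases j) => ->.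
  rewrite (_ : (fun y => _) = x0); first exact: dx0.
  by apply/funext => y; rewrite sigma0_00.
rewrite (_ : (fun y => _) = x0 * x1); first exact: (differentiableM (dx0 w) (dx1 w)).
by apply/funext => y; rewrite sigma0_01.
Qed.

Lemma differentiable_sigma1 w : differentiable (@sigma1 R) w.
Proof.
apply: differentiable_mx => i j; rewrite (ord1 i); case: (ord2_cases j) => ->.
  rewrite (_ : (fun y => _) = x0 * x1); first exact: (differentiableM (dx0 w) (dx1 w)).
  by apply/funext => y; rewrite sigma1_00.
rewrite (_ : (fun y => _) = x1); first exact: dx1.
by apply/funext => y; rewrite sigma1_01.
Qed.

Let entry0 (f : 'rV[C]_2 -> 'rV[C]_2) (g : 'rV[C]_2 -> C) (w u : 'rV[C]_2) (j : 'I_2) :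
  differentiable f w -> (forall y, f y 0 j = g y) -> 'd f w u 0 j = 'd g w u.
Proof.
move=> df fg; have e : (fun y => f y 0 j : C) = g by apply/funext.
exact: etrans (diff_entry _ _ _ df) (congr1 (fun F : 'rV[C]_2 -> C => 'd F w u) e).
Qed.

Lemma diff_sigma0 (w u : 'rV[C]_2) :
  'd (@sigma0 R) w u = pt2 (u 0 0) (w 0 0 * u 0 1 + w 0 1 * u 0 0).
Proof.
have d0 := differentiable_sigma0 w.
apply/rowP => j; case: (ord2_cases j) => ->; rewrite [RHS]mxE /=.
  exact: etrans (entry0 _ d0 sigma0_00) (diff_coord w u 0 0).
exact: etrans (entry0 _ d0 sigma0_01) (dx01 w u).
Qed.

Lemma diff_sigma1 (w u : 'rV[C]_2) :
  'd (@sigma1 R) w u = pt2 (w 0 0 * u 0 1 + w 0 1 * u 0 0) (u 0 1).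
Proof.
have d1 := differentiable_sigma1 w.
apply/rowP => j; case: (ord2_cases j) => ->; rewrite [RHS]mxE /=.
  exact: etrans (entry0 _ d1 sigma1_00) (dx01 w u).
exact: etrans (entry0 _ d1 sigma1_01) (diff_coord w u 0 1).
Qed.

Lemma pt2_mul (a b : C) (t : 'cV[C]_2) : pt2 a b *m t = (a * t 0 0 + b * t 1 0)%:M.
Proof.
apply/matrixP => i j; rewrite !ord1 !mxE eqxx big_ord_recl big_ord1.
by rewrite !mxE /=; congr (_ + _ * t _ _); exact: val_inj.
Qed.

Lemma jacobian_sigma0_eq0 (w : 'rV[C]_2) (t : 'cV[C]_2) :
  w 0 0 = 0 -> t 0 0 + w 0 1 * t 1 0 = 0 -> jacobian (@sigma0 R) w *m t = 0.
Proof.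
move=> w0 wt; apply/row_matrixP => i; rewrite rowE mulmxA mul_jacobian row0.
set u := delta_mx 0 i; rewrite diff_sigma0 pt2_mul w0 mul0r add0r.
by rewrite [w 0 1 * _]mulrC -mulrA -mulrDr wt mulr0 raddf0.
Qed.

Lemma jacobian_sigma1_eq0 (w : 'rV[C]_2) (t : 'cV[C]_2) :
  w = 0 -> t 1 0 = 0 -> jacobian (@sigma1 R) w *m t = 0.
Proof.
move=> w0 t0; apply/row_matrixP => i; rewrite rowE mulmxA mul_jacobian row0.
by rewrite diff_sigma1 pt2_mul t0 w0 !mxE !mul0r addr0 mul0r mulr0 addr0 raddf0.
Qed.

Section Vanish.
Variables (X Y : complexManifold R 2) (pi : X -> Y) (k : nat)
  (w : chart R Y 2 -> 'rV[C]_2 -> 'M[C]_(2, k)) (j : 'I_k).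
Hypotheses (hpi : holomorphic pi) (hw : holomorphic_forms w).

Lemma pullback_col_eq0 (psi : chart R Y 2) (phi0 phi : chart R X 2)
    (sigma : 'rV[C]_2 -> 'rV[C]_2) x chi :
  holomorphic_chart psi -> holomorphic_chart phi0 -> atlas phi -> atlas chi ->
  dom phi x -> dom phi0 x -> dom psi (pi x) -> dom chi (pi x) ->
  (forall x, dom phi0 x -> coord psi (pi x) = sigma (coord phi0 x)) ->
  differentiable sigma (coord phi0 x) ->
  jacobian sigma (coord phi0 x) *m col j
   (jacobian (in_charts id psi chi) (coord psi (pi x)) *m w chi (coord chi (pi x))) = 0 ->
  col j (pullback pi w phi (coord phi x)) = 0.
Proof.
move=> hpsi hphi0 aphi achi phix phi0x psix chix sE ds J0.
have hphi := atlas_holomorphic_chart aphi; have hchi := atlas_holomorphic_chart achi.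
rewrite (pullbackE hw (hpi x) hphi achi phix chix).
rewrite (jacobian_in_charts_change (hpi x) hphi hphi0 hchi hpsi phix phi0x chix psix).
have nE : \forall z \near coord phi0 x, sigma z = in_charts pi phi0 psi z.
  apply: filterS (cod_near (coord_cod phi0x)) => z cz.
  by rewrite /in_charts /= sE ?pointK//; exact: point_dom.
rewrite (jacobian_near nE ds).
have aux (A B D : 'M[C]_2) (W : 'M[C]_(2, k)) :
    B *m col j (D *m W) = 0 -> col j (A *m B *m D *m W) = 0.
  by rewrite !colE => h; rewrite -!mulmxA mulmxA in h *; rewrite h mulmx0.
exact: aux J0.
Qed.

(** The column t of w at p is annihilated by the Jacobian matrix of the blow-up at
    the point of the exceptional curve that stands for the kernel of t. *)
Lemma blowup_pullback_vanishes (p : Y) : is_blowup pi p ->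
  exists x, forall phi, atlas phi -> dom phi x ->
    col j (pullback pi w phi (coord phi x)) = 0.
Proof.
move=> [_ _ [psi [phi0 [phi1 [[hpsi hphi0 hphi1] [psip cp] dE [c0 c1 s0 s1] _]]]]].
have achi := chart_at_atlas p; have chip := chart_at_dom p.
set chi := chart_at p in achi chip.
pose t := col j (jacobian (in_charts id psi chi) (coord psi p) *m w chi (coord chi p)).
have p0 : cod psi 0 by rewrite -cp; exact: coord_cod.
have pE x : dom psi (pi x) -> coord psi (pi x) = 0 -> pi x = p.
  by move=> px e; rewrite -(coordK px) e -cp coordK.
(* t is the form at p; its kernel is spanned by (0, 1), the direction of the
   origin of phi1, or by (1, v) with v = - t 0 0 / t 1 0, that of (0, v) in phi0 *)
have [t1|t1] := eqVneq (t 1 0) 0.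
  have s10 : sigma1 (0 : 'rV[C]_2) = 0.
    by apply/rowP => i; case: (ord2_cases i) => ->; rewrite ?sigma1_00 ?sigma1_01 !mxE ?mul0r.
  have cz : cod phi1 0 by rewrite c1 /= s10.
  pose x := point phi1 0; have dx : dom phi1 x by exact: point_dom.
  have dpx : dom psi (pi x) by rewrite -[dom psi _]/((pi @^-1` dom psi) x) dE; right.
  have xp : pi x = p by apply: pE => //; rewrite s1// pointK.
  exists x => phi aphi phix.
  apply: (@pullback_col_eq0 psi phi1 phi (@sigma1 R) x chi) => //.
  - by rewrite xp.
  - exact: differentiable_sigma1.
  - by rewrite xp; apply: jacobian_sigma1_eq0 => //; rewrite pointK.
pose z : 'rV[C]_2 := pt2 0 (- t 0 0 / t 1 0).
have z0 : z 0 0 = 0 by rewrite mxE.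
have z1 : z 0 1 = - t 0 0 / t 1 0 by rewrite mxE.
have s00 : sigma0 z = 0.
  by apply/rowP => i; case: (ord2_cases i) => ->; rewrite ?sigma0_00 ?sigma0_01 z0 ?mul0r mxE.
have cz : cod phi0 z by rewrite c0 /= s00.
pose x := point phi0 z; have dx : dom phi0 x by exact: point_dom.
have dpx : dom psi (pi x) by rewrite -[dom psi _]/((pi @^-1` dom psi) x) dE; left.
have xp : pi x = p by apply: pE => //; rewrite s0// pointK.
exists x => phi aphi phix.
apply: (@pullback_col_eq0 psi phi0 phi (@sigma0 R) x chi) => //.
- by rewrite xp.
- exact: differentiable_sigma0.
- rewrite xp; apply: jacobian_sigma0_eq0; rewrite pointK//.
  by rewrite -/t z1 divfK// subrr.
Qed.

End Vanish.

Lemma near0_neq0 (P : C -> Prop) : (\forall t \near 0, P t) -> exists2 t, t != 0 & P t.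
Proof.
move=> /nbhsCP[e e0 eP]; exists (e / 2)%:C%C.
  by rewrite -modulus_eq0 modulus_real; [rewrite gt_eqF; lra|lra].
by apply: eP; rewrite subr0 modulus_real; lra.
Qed.

Lemma blowup_generic_coframe (X Y : complexManifold R 2) (pi : X -> Y) (p : Y)
    (w : chart R Y 2 -> 'rV[C]_2 -> 'M[C]_2) :
  is_blowup pi p -> generic_coframe w -> generic_coframe (pullback pi w).
Proof.
move=> [hpi [s [hs ps sp]]
  [psi [phi0 [phi1 [[hpsi hphi0 hphi1] [psip cp] dE [c0 c1 s0 s1] _]]]]].
apply: (@pullback_generic_coframe _ _ _ _ _ s [set y | y <> p]) => //.
  have -> : [set y : Y | y <> p] = ~` [set p] by [].
  apply: closed_openC; apply: accessible_closed_set1; apply: hausdorff_accessible.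
  exact: manifold_hausdorff.
move=> x U nU; have [xp|] := pselect (pi x = p);
  last by exists x => //; exact: nbhs_singleton.
(* sigma0 keeps the first coordinate and sigma1 the second; moving along it
   leaves the exceptional curve at once *)
have key (phi : chart R X 2) (sigma : 'rV[C]_2 -> 'rV[C]_2) (i : 'I_2) :
    dom phi x -> (forall x, dom phi x -> coord psi (pi x) = sigma (coord phi x)) ->
    (forall z, sigma z 0 i = z 0 i) -> exists2 y, U y & pi y <> p.
  move=> phix sE si; pose z := coord phi x.
  have nz : \forall z' \near z, cod phi z' /\ U (point phi z').
    by apply: filterS2 (cod_near (coord_cod phix)) (near_point phix nU).
  have lc : {for 0, continuous (fun t : C => z + t *: (delta_mx 0 i : 'rV[C]_2))}.
    apply: differentiable_continuous.
    have -> : (fun t : C => z + t *: (delta_mx 0 i : 'rV[C]_2)) =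
      cst z + ( *:%R ^~ (delta_mx 0 i) : C -> 'rV[C]_2) by [].
    by apply: differentiableD; [exact: differentiable_cst|exact: ex_diff].
  have [|t t0 [ct Ut]] := @near0_neq0 (fun t => cod phi (z + t *: delta_mx 0 i) /\
      U (point phi (z + t *: delta_mx 0 i))).
    have nz0 : nbhs (z + 0 *: delta_mx 0 i) [set z' | cod phi z' /\ U (point phi z')].
      by rewrite scale0r addr0; exact: nz.
    exact: (lc _ nz0).
  exists (point phi (z + t *: delta_mx 0 i)) => // yp.
  have := sE _ (point_dom ct); rewrite yp cp pointK// => /matrixP/(_ 0 i).
  rewrite si !mxE !eqxx mulr1 => e.
  have := sE _ phix; rewrite xp cp => /matrixP/(_ 0 i); rewrite si mxE => e'.
  by move: e; rewrite /z -e' add0r => /esym/eqP; rewrite (negbTE t0).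
have : (dom phi0 `|` dom phi1) x by rewrite -dE /= xp.
by case=> dx; [apply: (key phi0 _ 0 dx s0) => z; rewrite sigma0_00|
  apply: (key phi1 _ 1 dx s1) => z; rewrite sigma1_01].
Qed.

End Blowup.

(** * Coframes on tori, curves and products *)

Section Coframes.
Variable R : realType.
Local Notation C := (Cplx R).

(** The forms dz_i of the quotient charts: transitions between these charts are
    locally translations, so the forms do not depend on the quotient chart, and in
    a chart of the atlas their matrix is a Jacobian matrix. *)
Lemma torus_generic_coframe n (Y : complexManifold R n) :
  complex_torus Y -> exists w : chart R Y n -> _, generic_coframe w.
Proof.
move=> [e [q [_ qsurj qP qchartP]]].
pose qchart (chi : chart R Y n) :=
  holomorphic_chart chi /\ (forall w, cod chi w -> point chi w = q w).
have ex y : exists chi, qchart chi /\ dom chi y.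
  have [z <-] := qsurj y; have [chi [hchi cz cq]] := qchartP z.
  by exists chi; split=> //; rewrite -cq//; exact: point_dom.
have [chi_at chi_atP] := choice ex.
(* near y two local inverses of q differ by a constant lattice vector l *)
have trans chi chi' y : qchart chi -> qchart chi' -> dom chi y -> dom chi' y ->
    jacobian (in_charts id chi chi') (coord chi y) = 1%:M.
  move=> [hc qc] [hc' qc'] cy cy'.
  set w0 := coord chi y; set w0' := coord chi' y.
  have c0 : cod chi w0 := coord_cod cy; have c0' : cod chi' w0' := coord_cod cy'.
  pose l := w0' - w0.
  have ll : lattice e l.
    by apply/qP; rewrite -(qc w0 c0) -(qc' w0' c0') !coordK.
  pose t := (id : 'rV[C]_n -> 'rV[C]_n) + cst l.
  have dt w : differentiable t w.
    by apply: differentiableD; [exact: ex_diff|exact: differentiable_cst].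
  have t0 : t w0 = w0' by rewrite /t fctE /= addrC subrK.
  have nt : \forall w \near w0, cod chi' (t w).
    have nc : nbhs (t w0) (cod chi') by rewrite t0; exact: cod_near.
    have ct : {for w0, continuous t} by exact: differentiable_continuous (dt w0).
    exact: (ct _ nc).
  have nE : \forall w \near w0, t w = in_charts id chi chi' w.
    apply: filterS2 (cod_near c0) nt => w cw cw'.
    rewrite /in_charts /= (qc w cw).
    have -> : q w = q (t w).
      by apply/esym/qP; rewrite /t fctE /= addrAC subrr add0r.
    by rewrite -(qc' _ cw') pointK.
  rewrite (jacobian_near nE (dt w0)); apply: jacobianP => u.
  rewrite /t diffD; [|exact: ex_diff|exact: differentiable_cst].
  have d1 : 'd (id : 'rV[C]_n -> 'rV[C]_n) w0 u = u by rewrite diff_val.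
  have d2 : 'd (cst l : 'rV[C]_n -> 'rV[C]_n) w0 u = 0 by rewrite diff_cst.
  rewrite mulmx1; exact: etrans (f_equal2 +%R d1 d2) (addr0 u).
pose w (phi : chart R Y n) (z : 'rV[C]_n) : 'M[C]_n :=
  jacobian (in_charts id phi (chi_at (point phi z))) z.
have wE phi chi y : holomorphic_chart phi -> qchart chi -> dom phi y -> dom chi y ->
    w phi (coord phi y) = jacobian (in_charts id phi chi) (coord phi y).
  move=> hphi qc phiy chiy.
  have e1 : w phi (coord phi y) = jacobian (in_charts id phi (chi_at y)) (coord phi y).
    by rewrite /w (coordK phiy).
  have [qy dy] := chi_atP y.
  have T := trans _ _ _ qc qy chiy dy.
  have e2 := jacobian_transition hphi qc.1 qy.1 phiy chiy dy.
  have e3 := congr1 (mulmx (jacobian (in_charts id phi chi) (coord phi y))) T.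
  have e4 := etrans e1 e2. have e5 := etrans e4 e3. have e6 := etrans e5 (mulmx1 _).
  exact: e6.
have hw : holomorphic_forms w.
  split.
    move=> phi aphi z phiz; have dz := point_dom phiz.
    have hphi := atlas_holomorphic_chart aphi.
    have [qc dc] := chi_atP (point phi z); set chi := chi_at _ in qc dc.
    have nz : \forall z' \near z, cod phi z' /\ dom chi (point phi z').
      rewrite -(pointK phiz).
      by apply: filterS2 (cod_near (coord_cod dz)) (near_point dz (dom_near dc)).
    have dJ : differentiable (jacobian (in_charts id phi chi)) z.
      apply: differentiable_jacobian; apply: filterS nz => z' [cz' dz'].
      rewrite -(pointK cz'); apply: differentiable_transition => //.
        exact: qc.1.
      exact: point_dom.
    apply: (near_eq_diff _ dJ).1; apply: filterS nz => z' [cz' dz'].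
    have := wE _ _ _ hphi qc (point_dom cz') dz'.
    by rewrite (pointK cz') => ->.
  move=> phi psi aphi apsi z [phiz psiz].
  have dz : dom phi (point phi z) := point_dom phiz.
  have hphi := atlas_holomorphic_chart aphi.
  have hpsi := atlas_holomorphic_chart apsi.
  have [qc dc] := chi_atP (point phi z).
  have e1 := wE _ _ _ hphi qc dz dc; have e2 := wE _ _ _ hpsi qc psiz dc.
  have e3 := jacobian_transition hphi hpsi qc.1 dz psiz dc.
  by rewrite (pointK phiz) in e1 e3; rewrite e1 e3 /transition /= e2.
exists w; split=> // x U nU; exists x; first exact: nbhs_singleton.
exists (chart_at x); have ha := chart_at_atlas x; have da := chart_at_dom x.
have hphi := atlas_holomorphic_chart ha.
have [qc dc] := chi_atP x.
split=> //; rewrite (wE _ _ _ hphi qc da dc).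
exact: (jacobian_transition_unit hphi qc.1 da dc).
Qed.

(** The interior of the zero set of a form is closed by the identity theorem, and
    it is not the whole curve for a member of a basis of the space of forms. *)
Lemma curve_generic_coframe (W : complexManifold R 1) g :
  connected [set: W] -> has_genus W g -> (0 < g)%N ->
  exists w : chart R W 1 -> _, generic_coframe w.
Proof.
move=> conW [b [hb bfree _]] g0; pose i0 := Ordinal g0.
pose w := b i0.
have hw : holomorphic_forms w := hb i0.
exists w; split=> //.
have unitE (A : 'M[C]_1) : (A \in unitmx) = (A 0 0 != 0).
  by rewrite unitmxE det_mx11 unitfE.
have nframe phi y : atlas phi -> dom phi y ->
    ~ frame_at w y <-> w phi (coord phi y) 0 0 = 0.
  move=> aphi phiy; split=> [nf|w0 fy].
    by apply/eqP/negP => /negP wn; apply: nf; exists phi; split=> //; rewrite unitE.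
  by have := frame_atP hw fy aphi phiy; rewrite unitE w0 eqxx.
pose N := [set x : W | \forall y \near x, ~ frame_at w y].
have oN : open N.
  rewrite openE => x Nx; rewrite /interior.
  by apply: near_join; exact: Nx.
have cN : closed N.
  move=> x clx.
  have ha := chart_at_atlas x; have da := chart_at_dom x.
  set phi := chart_at x in ha da; pose z := coord phi x.
  have /nbhsVP[r r0 Hr] := cod_near (coord_cod da).
  have nb : nbhs x [set y | dom phi y /\ rnorm (coord phi y - z) < r / 4].
    apply: filterS2 (dom_near da)
      (near_coord da (P := fun z' => rnorm (z' - z) < r / 4) _).
      by [].
    by apply/nbhsVP; exists (r / 4) => //; lra.
  have [y [Ny [phiy yr]]] := clx _ nb.
  have cp z' : rnorm (z' - z) < r -> cod phi z' by exact: Hr.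
  have fz z' : rnorm (z' - z) < r / 4 -> w phi z' 0 0 = 0.
    apply: (@identity_ball R _ (fun z' => w phi z' 0 0) z (coord phi y) r _ yr).
      move=> z2 /cp cz2; apply: differentiable_entry; exact: hw.1 ha _ cz2.
    have nN : \forall y' \near y, dom phi y' /\ ~ frame_at w y'.
      by apply: filterS2 (dom_near phiy) Ny.
    apply: filterS2 (cod_near (coord_cod phiy)) (near_point phiy nN) => z2 cz2 [dz2 nf].
    by have := (nframe _ _ ha dz2).1 nf; rewrite pointK.
  apply: filterS nb => y' [dy' /fz wy']; exact: (nframe _ _ ha dy').2 wy'.
(* N is the whole curve only if b i0 = 0, against linear independence *)
have N0 : N = set0.
  apply: contrapT => /eqP/set0P Nn0.
  have NT : N = setT.
    by apply: conW => //; exists N; rewrite ?setTI.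
  have := bfree (fun i => (i == i0)%:R).
  have H : forall phi, atlas phi -> forall z, cod phi z ->
      \sum_i (i == i0)%:R *: b i phi z = 0.
    move=> phi aphi z cz; rewrite (bigD1 i0)// eqxx mulr1n scale1r /= big1 ?addr0.
      have dz := point_dom cz.
      have : N (point phi z) by rewrite NT.
      move=> /nbhs_singleton /(nframe _ _ aphi dz).1; rewrite pointK// => e.
      by apply/matrixP => i j; rewrite !ord1 [RHS]mxE; exact: e.
    by move=> i /negbTE ->; rewrite scale0r.
  by move=> /(_ H i0) /eqP; rewrite eqxx oner_eq0.
move=> x U nU; apply: contrapT => nf.
have : N x.
  by apply: filterS nU => y Uy fy; apply: nf; exists y.
by rewrite N0.
Qed.

Lemma product_generic_coframe n m (X : complexManifold R n) (Y : complexManifold R m)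
    (u : chart R X n -> 'rV[C]_n -> 'M[C]_n) (v : chart R Y m -> 'rV[C]_m -> 'M[C]_m) :
  generic_coframe u -> generic_coframe v ->
  exists w : chart R (prod_manifold X Y) (n + m) -> _, generic_coframe w.
Proof.
move=> [hu du] [hv dv].
pose blk (phi : chart R X n) (psi : chart R Y m) (z : 'rV[C]_(n + m)) : 'M[C]_(n + m) :=
  block_mx (u phi (lsubmx z)) 0 0 (v psi (rsubmx z)).
(* a chart of the product may arise from several pairs of charts: choose one *)
have ex (chi : chart R (prod_manifold X Y) (n + m)) :
    exists W : 'rV[C]_(n + m) -> 'M[C]_(n + m), atlas chi ->
      exists phi psi,
        [/\ atlas phi, atlas psi, chi = prod_chart phi psi & W = blk phi psi].
  have [[phi [psi [aphi apsi ->]]]|na] := pselect (atlas chi).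
    by exists (blk phi psi) => _; exists phi, psi.
  by exists (fun=> 0) => /na.
have [w wP] := choice ex.
have hw : holomorphic_forms w.
  split.
    move=> chi /wP[phi [psi [aphi apsi -> ->]]] z [/= zl zr].
    apply: differentiable_block.
      exact: (differentiable_comp (differentiable_lsubmx _) (hu.1 phi aphi _ zl)).
    exact: (differentiable_comp (differentiable_rsubmx _) (hv.1 psi apsi _ zr)).
  move=> chi chi' /wP[phi [psi [aphi apsi -> ->]]] /wP[phi' [psi' [aphi' apsi' -> ->]]].
  move=> z [[/= zl zr] [/= zl' zr']].
  have ol : overlap phi phi' (lsubmx z) by split.
  have or : overlap psi psi' (rsubmx z) by split.
  have J := jacobian_row_mx (atlas_holomorphic aphi aphi' ol)
    (atlas_holomorphic apsi apsi' or).
  have eJ : jacobian (transition (prod_chart phi psi) (prod_chart phi' psi')) z =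
    block_mx (jacobian (transition phi phi') (lsubmx z)) 0 0
             (jacobian (transition psi psi') (rsubmx z)) by exact: J.
  have G : blk phi psi z =
      block_mx (jacobian (transition phi phi') (lsubmx z)) 0 0
               (jacobian (transition psi psi') (rsubmx z)) *m
      blk phi' psi' (row_mx (transition phi phi' (lsubmx z))
                            (transition psi psi' (rsubmx z))).
    rewrite /blk row_mxKl row_mxKr mulmx_block !mulmx0 !mul0mx !addr0 add0r.
    by rewrite -(hu.2 _ _ aphi aphi' _ ol) -(hv.2 _ _ apsi apsi' _ or).
  by rewrite -eJ in G; exact: G.
exists w; split=> // -[x y] U [[A B] [/= nA nB] AB].
have [x' Ax' fx'] := du x A nA; have [y' By' fy'] := dv y B nB.
exists (x', y'); first exact: AB.
pose chi : chart R (prod_manifold X Y) (n + m) :=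
  prod_chart (chart_at x') (chart_at y').
have achi : atlas chi.
  by exists (chart_at x'), (chart_at y'); split=> //; exact: chart_at_atlas.
have dchi : dom chi (x', y') by split; exact: chart_at_dom.
exists chi; split=> //.
have [phi [psi [aphi apsi cE ->]]] := wP chi achi.
rewrite cE in dchi *; have [/= dx dy] := dchi.
rewrite /blk row_mxKl row_mxKr unitmxE det_ublock unitrM -!unitmxE.
by rewrite (frame_atP hu fx' aphi dx) (frame_atP hv fy' apsi dy).
Qed.

End Coframes.

(** * Symmetric tensors on a blow-up *)

Section Vanishing.
Variable R : realType.
Local Notation C := (Cplx R).

(** The points where F takes a given value of maximal modulus form a closed set,
    open by [strong_maximum] on the lines through its points in a chart. *)
Lemma holomorphic_fun_cst n (X : complexManifold R n) (F : X -> C) :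
  compact_connected X ->
  (forall phi : chart R X n, atlas phi -> forall z, cod phi z ->
    differentiable (F \o point phi) z) ->
  forall x y, F x = F y.
Proof.
move=> [cX conX] dF x1 x2.
have cF : continuous F.
  move=> x; have ha := chart_at_atlas x; have da := chart_at_dom x.
  set phi := chart_at x in ha da.
  have c1 : {for x, continuous ((F \o point phi) \o coord phi)}.
    apply: continuous_comp; first exact: coord_continuous.
    exact: (differentiable_continuous (dF phi ha _ (coord_cod da))).
  move=> A nA; have nA' : nbhs (((F \o point phi) \o coord phi) x) A.
    by rewrite /= coordK.
  have nx : nbhs x (((F \o point phi) \o coord phi) @^-1` A) := c1 _ nA'.
  by apply: filterS2 nx (dom_near da) => y /= + dy; rewrite coordK.
have X0 : [set: X] !=set0 by exists x1.
have [|x0 _ xmax] := compact_EVT_max (f := fun x => modulus (F x)) X0 cX.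
  apply: continuous_subspaceT => x; apply: continuous_comp; first exact: cF.
  exact: modulus_continuous.
have {}xmax x : modulus (F x) <= modulus (F x0) by exact: xmax (mem_set I).
pose K := [set x | F x = F x0].
have cK : closed K.
  apply: (@closed_comp _ _ F [set c | c = F x0]); first by move=> x _; exact: cF.
  exact: accessible_closed_set1 (hausdorff_accessible (@norm_hausdorff _ C)) _.
have oK : open K.
  rewrite openE => x Kx; rewrite /interior.
  have ha := chart_at_atlas x; have da := chart_at_dom x.
  set phi := chart_at x in ha da; pose z := coord phi x.
  have /nbhsVP[r r0 Hr] := cod_near (coord_cod da).
  have nz : \forall z' \near z, F (point phi z') = F x0.
    apply/nbhsVP; exists (r / 2); first by lra.
    move=> z' zr; pose v := z' - z.
    have inr (t : C) : modulus (t - 0) <= 2 -> cod phi (z + t *: v).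
      rewrite subr0 => t2; apply: Hr; rewrite addrAC subrr add0r rnormZ.
      by have := modulus_ge0 t; have := rnorm_ge0 v; rewrite /v; nra.
    have := @strong_maximum R (fun t => F (point phi (z + t *: v))) 0 2.
    rewrite scale0r addr0 /z coordK// Kx => H.
    have -> : z' = coord phi x + 1 *: v by rewrite scale1r addrC subrK.
    apply: H.
    - move=> t /inr ct.
      exact: (@differentiable_line _ _ (F \o point phi) z v t (dF phi ha _ ct)).
    - by move=> t _; exact: xmax.
    - by rewrite subr0 modulus1; lra.
  apply: filterS2 (dom_near da) (near_coord da nz) => y dy.
  by rewrite coordK.
have KT : K = setT.
  apply: conX; first by exists x0.
  - by exists K; rewrite ?setTI.
  - by exists K; rewrite ?setTI.
have h1 : K x1 by rewrite KT.
have h2 : K x2 by rewrite KT.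
by rewrite h1 h2.
Qed.

Lemma biholomorphic_generic_coframe n (X Y : complexManifold R n) :
  biholomorphic X Y ->
  (exists w : chart R Y n -> _, generic_coframe w) ->
  exists w : chart R X n -> _, generic_coframe w.
Proof.
move=> [f [g [hf hg gf fg]]] [w gw]; exists (pullback f w).
apply: (@pullback_generic_coframe _ _ _ _ f g setT) => //.
  exact: openT.
by move=> x U nU; exists x => //; exact: nbhs_singleton.
Qed.

Lemma iterated_blowup_generic_coframe (X Y : complexManifold R 2) :
  iterated_blowup Y X ->
  (exists w : chart R Y 2 -> _, generic_coframe w) ->
  exists w : chart R X 2 -> _, generic_coframe w.
Proof.
move=> YX ew; elim: YX => [Z|Z Z' pi p _ [w gw] bl].
  by move=> /biholomorphic_generic_coframe; exact.
by exists (pullback pi w); exact: blowup_generic_coframe bl gw.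
Qed.

Lemma blowup_H0_S2T_eq0 (X Z : complexManifold R 2) (pi : X -> Z) (p : Z)
    (w : chart R Z 2 -> 'rV[C]_2 -> 'M[C]_2) :
  compact_connected X -> is_blowup pi p -> generic_coframe w -> H0_S2T_eq0 X.
Proof.
move=> cX bl gw s [sd _ sT].
have [hW dW] := blowup_generic_coframe bl gw.
have hpi : holomorphic pi by case: bl.
set W := pullback pi w in hW dW.
(* the contractions of s with all pairs of columns of W *)
pose G (phi : chart R X 2) (z : 'rV[C]_2) : 'M[C]_2 :=
  (W phi z)^T *m s phi z *m W phi z.
have GE phi psi x : atlas phi -> atlas psi -> dom phi x -> dom psi x ->
    G phi (coord phi x) = G psi (coord psi x).
  move=> aphi apsi phix psix.
  have eW := forms_change hW aphi apsi phix psix.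
  have eS := sT phi psi aphi apsi _ (overlap_coord phix psix).
  have TE : transition phi psi (coord phi x) = coord psi x.
    by rewrite /transition /= (coordK phix).
  by rewrite TE in eS; rewrite /G eS eW trmx_mul !mulmxA.
pose F i j (x : X) : C := G (chart_at x) (coord (chart_at x) x) i j.
have FE i j phi x : atlas phi -> dom phi x -> F i j x = G phi (coord phi x) i j.
  move=> aphi phix.
  by rewrite /F (GE _ _ _ (chart_at_atlas x) aphi (chart_at_dom x) phix).
have dF i j (phi : chart R X 2) : atlas phi -> forall z, cod phi z ->
    differentiable (F i j \o point phi) z.
  move=> aphi z cz.
  have dG : differentiable (fun z => G phi z i j) z.
    apply: differentiable_entry; apply: differentiable_mulmx.
      apply: differentiable_mulmx; last exact: sd phi aphi z cz.
      exact: differentiable_trmx (hW.1 phi aphi z cz).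
    exact: (hW.1 phi aphi z cz).
  apply: (near_eq_diff _ dG).1; apply: filterS (cod_near cz) => z' cz'.
  by rewrite /= (FE i j phi _ aphi (point_dom cz')) (pointK cz').
have F0 i j x : F i j x = 0.
  have [y Hy] := blowup_pullback_vanishes i hpi gw.1 bl.
  rewrite (holomorphic_fun_cst cX (dF i j) x y) /F.
  have := Hy _ (chart_at_atlas y) (chart_at_dom y).
  set phi := chart_at y; set z := coord phi y => W0.
  have -> : G phi z i j = ((col i (W phi z))^T *m (s phi z *m W phi z)) 0 j.
    by rewrite /G -mulmxA !mxE; apply: eq_bigr => l _; rewrite !mxE.
  by rewrite W0 trmx0 mul0mx mxE.
have s0 x phi : frame_at W x -> atlas phi -> dom phi x -> s phi (coord phi x) = 0.
  move=> fx aphi phix.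
  have Wu := frame_atP hW fx aphi phix.
  have G0 : G phi (coord phi x) = 0.
    by apply/matrixP => i j; rewrite -(FE i j phi x aphi phix) F0 mxE.
  have WTu : (W phi (coord phi x))^T \in unitmx by rewrite unitmx_tr.
  rewrite -[s _ _](mulKmx WTu) -[_ *m s _ _](mulmxK Wu).
  by rewrite -[_ *m _ *m W _ _]/(G phi (coord phi x)) G0 mul0mx mulmx0.
move=> phi aphi z cz; apply: contrapT => sz.
have nz : \forall z' \near z, s phi z' <> 0.
  have cs : {for z, continuous (s phi)}.
    exact: differentiable_continuous (sd phi aphi z cz).
  have oA : open [set A : 'M[C]_2 | A <> 0].
    rewrite (_ : [set A : 'M[C]_2 | A <> 0] = ~` [set 0])//.
    apply: closed_openC; apply: accessible_closed_set1; apply: hausdorff_accessible.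
    exact: norm_hausdorff.
  have nA : nbhs (s phi z) [set A : 'M[C]_2 | A <> 0] by exact: open_nbhs_nbhs.
  exact: (cs _ nA).
have dz := point_dom cz.
have nx : \forall y \near point phi z, dom phi y /\ s phi (coord phi y) <> 0.
  apply: filterS2 (dom_near dz) (near_coord dz (P := fun z' => s phi z' <> 0) _).
    by [].
  by rewrite (pointK cz).
have [y [dy sy] fy] := dW _ _ nx.
exact: sy (s0 _ _ fy aphi dy).
Qed.

End Vanishing.

Theorem lemma4p7 (R : realType) (X Y : complexManifold R 2) :
  compact_connected X ->
  minimal_model X Y ->
  ~ biholomorphic Y X ->
  (complex_torus Y \/
   exists C W : complexManifold R 1,
     [/\ elliptic_curve C,
         compact_connected W,
         exists g : nat, has_genus W g /\ (2 <= g)%N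
       & biholomorphic Y (prod_manifold C W)]) ->
  H0_S2T_eq0 X.
Proof.
move=> cX [_ _ YX] nYX base.
have ew : exists w : chart R Y 2 -> _, generic_coframe w.
  case: base => [/torus_generic_coframe//|[E [W [tE [_ conW] [g [hg g2]] YEW]]]].
  have [u gu] := torus_generic_coframe tE.
  have [v gv] := curve_generic_coframe conW hg (ltnW g2).
  apply: (@biholomorphic_generic_coframe R 2 Y (prod_manifold E W) YEW).
  exact: product_generic_coframe gu gv.
case: YX cX nYX => [Z [f [g [hf hg gf fg]]] _ []|Z Z' pi p YZ bl cZ' _].
  by exists g, f.
have [w gw] := iterated_blowup_generic_coframe YZ ew.
exact: blowup_H0_S2T_eq0 cZ' bl gw.
Qed.
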